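(* Let $p \geq 2$ be an integer and let $\mathbf{A}$ be a spectrally unitary $\mathbb{Z}^p$-action on $H_1(\mathbb{T}^3, \mathbb{Z}) \cong \mathbb{Z}^3$. Then there exists a free real analytic $\mathbb{Z}^p$-action $\varphi$ on the torus $\mathbb{T}^3 = \mathbb{R}^3/\mathbb{Z}^3$ whose induced action on the first homology group $H_1(\mathbb{T}^3,\mathbb{Z})$ is $\mathbf{A}$.
   Context: A real analytic $\mathbb{Z}^p$-action on $\mathbb{T}^q$ is a group homomorphism $\varphi$ from $\mathbb{Z}^p$ into the group of real analytic diffeomorphisms of $\mathbb{T}^q$. Its induced action $\varphi_*$ is the $\mathbb{Z}^p$-action on $H_1(\mathbb{T}^q,\mathbb{Z}) = \mathbb{Z}^q$ given by $\ell \mapsto \varphi(\ell)_*$ (the map induced on first homology), which acts by automorphisms of $\mathbb{Z}^q$. The action $\varphi$ is free if $\varphi(\ell)$ has no fixed points for every $\ell \in \mathbb{Z}^p \setminus \{0\}$. A $\mathbb{Z}^p$-action $\mathbf{A}$ on $\mathbb{Z}^q$ is spectrally unitary if it acts by automorphisms of $\mathbb{Z}^q$ (i.e. is a homomorphism $\mathbb{Z}^p \to \mathrm{GL}(q,\mathbb{Z})$) and $1$ is an eigenvalue of $\mathbf{A}(\ell)$ for every $\ell \in \mathbb{Z}^p$. *)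

(* Defs.v *)
From HB Require Import structures.
From mathcomp Require Import all_boot all_order all_algebra.
From mathcomp Require Import all_classical all_reals all_analysis.
From mathcomp Require Import Rstruct Rstruct_topology.
Set Implicit Arguments. Unset Strict Implicit. Unset Printing Implicit Defensive.
Import Order.TTheory GRing.Theory Num.Theory.
Local Open Scope classical_set_scope.
Local Open Scope ring_scope.

Notation Rl := Rdefinitions.R.

Definition spectrally_unitary (p : nat) (A : 'cV[int]_p -> 'M[int]_3) : Prop :=
  (forall l m : 'cV[int]_p, A (l + m) = A l *m A m) /\
  (forall l, A l \in unitmx) /\
  (forall l, eigenvalue (map_mx (intr : int -> rat) (A l)) 1).

Definition in_lattice (x : 'cV[Rl]_3) : Prop := forall i, x i 0 \is a Num.int.

Definition mono (d : 'cV[Rl]_3) (a : 'I_3 -> nat) : Rl :=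
  \prod_(i < 3) d i 0 ^+ a i.

Definition analytic_at (f : 'cV[Rl]_3 -> Rl) (x0 : 'cV[Rl]_3) : Prop :=
  exists r : Rl, 0 < r /\
  exists c : ('I_3 -> nat) -> Rl,
    forall y : 'cV[Rl]_3, (forall i, `|y i 0 - x0 i 0| < r) ->
      (exists B : Rl, forall N : nat,
          \sum_(a : {ffun 'I_3 -> 'I_N})
             `|c (fun i => nat_of_ord (a i)) * mono (y - x0) (fun i => nat_of_ord (a i))| <= B)
      /\ ((fun N : nat => \sum_(a : {ffun 'I_3 -> 'I_N})
             c (fun i => nat_of_ord (a i)) * mono (y - x0) (fun i => nat_of_ord (a i)))
          @ \oo --> f y).

Definition real_analytic (F : 'cV[Rl]_3 -> 'cV[Rl]_3) : Prop :=
  forall (i : 'I_3) (x0 : 'cV[Rl]_3), analytic_at (fun x => F x i 0) x0.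

(* A real analytic Z^p-action on T^3 = R^3/Z^3, given by lifts F l : R^3 -> R^3 of
   the torus maps phi(l).  The map phi(l) on the torus is well defined and its
   induced map on H_1(T^3,Z) = Z^3 is M l exactly when
   F l (x + k) = F l x + (M l) k for all k in Z^3. *)
Definition induces (p : nat) (F : 'cV[int]_p -> 'cV[Rl]_3 -> 'cV[Rl]_3)
    (M : 'cV[int]_p -> 'M[int]_3) : Prop :=
  forall l (x : 'cV[Rl]_3) (k : 'cV[int]_3),
    F l (x + map_mx intr k) = F l x + map_mx intr (M l *m k).

(* group action: phi(0) = id and phi(l + m) = phi(l) o phi(m) on the torus;
   hence each phi(l) is a bijection with inverse phi(-l), so a real analytic
   diffeomorphism as soon as all phi(l) are real analytic. *)
Definition torus_action (p : nat) (F : 'cV[int]_p -> 'cV[Rl]_3 -> 'cV[Rl]_3) : Prop :=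
  (forall x, in_lattice (F 0 x - x)) /\
  (forall l m x, in_lattice (F (l + m) x - F l (F m x))) /\
  (forall l, real_analytic (F l)).

Definition free_action (p : nat) (F : 'cV[int]_p -> 'cV[Rl]_3 -> 'cV[Rl]_3) : Prop :=
  forall l, l != 0 -> forall x, ~ in_lattice (F l x - x).

(* Main.v *)
Require Import Defs.
From mathcomp Require Import all_boot all_order all_algebra.
From mathcomp Require Import all_classical all_reals all_analysis.
From mathcomp Require Import Rstruct Rstruct_topology.
From mathcomp Require Import ring lra zify.
Import Order.TTheory GRing.Theory Num.Theory.
Import numFieldNormedType.Exports.
Local Open Scope ring_scope.

(* Over the rationals, either the matrices A(l) have a common nonzero fixed row v
   and a common nonzero fixed column w, or they are simultaneously diagonalizable
   with three nontrivial characters whose kernels cover Z^p; in the latter case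
   the characters are sign characters s, se, e factoring through the Klein
   four-group.

   In the first case an affine action x |-> A(l) x + b(l) works.  Take
   b = sum_j tau^(j+1) B_j with tau transcendental and B_j rational cocycles.
   Such an action is free as soon as for each l <> 0 some rational v fixed by
   A(l) has v B_j(l) <> 0 for some j: otherwise tau would satisfy a polynomial
   equation.  If v w <> 0 the cocycles l_i w suffice; if v w = 0 the A(l) are
   simultaneously triangular, with diagonal 1, e, 1, and suitable cocycles are
   written down explicitly.

   In the Klein case no affine action is free.  Let u be a primitive integer row
   with u A(l) = e(l) u, and w0, w1 the other two eigencolumns.  Then the flow
   x |-> x + t (cos(2 pi u x) w0 + sin(2 pi u x) w1) commutes with an affine
   action of Z^p which moves the circle u x by half-turns and reflections;
   compose the two, with t = sum_i l_i tau^(i+1).  A fixed point would make t^2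
   rational. *)

(** * A transcendental number *)

Local Open Scope classical_set_scope.

Lemma poly_roots_in_seq (K : idomainType) (P : {poly K}) :
  P != 0 -> exists s : seq K, forall x, root P x -> x \in s.
Proof.
have [n] := ubnP (size P); elim: n P => // n IHn P ltPn P0.
have [[x Px]|noroot] := pselect (exists x, root P x); last first.
  by exists [::] => x Px; case: noroot; exists x.
have /factor_theorem[Q PQ] := Px; move: P0; rewrite PQ mulf_eq0 polyXsubC_eq0 orbF => Q0.
have [|//|s hs] := IHn Q.
  by move: ltPn; rewrite PQ size_Mmonic ?monicXsubC // size_XsubC addn2.
exists (x :: s) => y; rewrite rootM root_XsubC inE => /orP[/hs->|->//].
by rewrite orbT.
Qed.

(** The algebraic numbers lie in a countable union of finite root sets, which has Lebesgue measure
    zero, whereas [[0, 1]] has measure 1. *)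
Lemma transcendental_exists :
  exists tau : Rl, forall P : {poly rat}, P != 0 -> (map_poly ratr P).[tau] != 0.
Proof.
pose Z (P : {poly rat}) : set Rl := [set x | P != 0 /\ (map_poly ratr P).[x] = 0].
have cZ : countable (\bigcup_P Z P).
  apply: bigcup_countable => [|P _]; first exact: countableP.
  have [->|P0] := eqVneq P 0.
    by rewrite (_ : Z 0 = set0) // -subset0 => x [] /eqP.
  have mP0 : map_poly ratr P != 0 :> {poly Rl} by rewrite map_poly_eq0.
  have [s hs] := poly_roots_in_seq _ _ mP0.
  apply: (@sub_countable _ _ _ [set` s]); last exact/finite_set_countable/finite_seq.
  by apply: subset_card_le => x [_ /rootP/hs].
apply: contrapT => /forallNP noT.
have ZT : \bigcup_P Z P = [set: Rl].
  rewrite -subTset => x _; have /existsNP[P /not_implyP[P0 /negP/negPn/eqP Px]] := noT x.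
  by exists P.
have := @countable_lebesgue_measure0 Rl `[0, 1].
rewrite (sub_countable (subset_card_le (@subsetT _ _))) -?ZT // => /(_ isT).
rewrite lebesgue_measure_itv /= lte01 oppr0 adde0 => /eqP.
by rewrite eqe oner_eq0.
Qed.

(** * Real analytic functions *)

Lemma cvgn_ext (u v : nat -> Rl) (l : Rl) : u =1 v -> u @ \oo --> l -> v @ \oo --> l.
Proof. by move/funext->. Qed.

(* [cvgD] and [cvgM] do not unify with the topology that Rstruct_topology copies to [Rl]. *)
Lemma Rl_cvgD (u v : nat -> Rl) (a b : Rl) :
  u @ \oo --> a -> v @ \oo --> b -> (fun n => u n + v n) @ \oo --> a + b.
Proof. exact: (@cvgD (Rl : realType) (Rl : realType)). Qed.

Lemma Rl_cvgM (u v : nat -> Rl) (a b : Rl) :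
  u @ \oo --> a -> v @ \oo --> b -> (fun n => u n * v n) @ \oo --> a * b.
Proof. exact: (@cvgM (Rl : realType)). Qed.

Lemma analytic_atD f g x0 : analytic_at f x0 -> analytic_at g x0 ->
  analytic_at (fun x => f x + g x) x0.
Proof.
move=> [r [r0 [c hc]]] [s [s0 [e he]]]; exists (Num.min r s); split.
  by rewrite lt_min r0 s0.
exists (fun a => c a + e a) => y hy.
have [|[B1 hB1] cv1] := hc y.
  by move=> i; apply: lt_le_trans (hy i) _; rewrite ge_min lexx.
have [|[B2 hB2] cv2] := he y.
  by move=> i; apply: lt_le_trans (hy i) _; rewrite ge_min lexx orbT.
split.
  exists (B1 + B2) => N; apply: le_trans (lerD (hB1 N) (hB2 N)).
  by rewrite -big_split ler_sum //= => a _; rewrite mulrDl ler_normD.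
apply: (cvgn_ext _ _ _ _ (Rl_cvgD _ _ _ _ cv1 cv2)) => N /=.
by rewrite -big_split; apply: eq_bigr => a _; rewrite mulrDl.
Qed.

Lemma analytic_atZ (k : Rl) f x0 : analytic_at f x0 -> analytic_at (fun x => k * f x) x0.
Proof.
move=> [r [r0 [c hc]]]; exists r; split=> //.
exists (fun a => k * c a) => y /hc [[B hB] cv]; split.
  exists (`|k| * B) => N; under eq_bigr do rewrite -mulrA normrM.
  by rewrite -mulr_sumr ler_wpM2l.
apply: (cvgn_ext _ _ _ _ (Rl_cvgM _ _ _ _ (@cvg_cst _ k _ \oo _) cv)) => N /=.
by rewrite mulr_sumr; apply: eq_bigr => a _; rewrite mulrA.
Qed.

(** Expanded at 0 only: the argument will be a displacement [x i 0 - x0 i 0] from the base point. *)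
Definition entire (f : Rl -> Rl) : Prop := exists c : nat -> Rl, forall d : Rl,
  (exists B : Rl, forall N : nat, \sum_(n < N) `|c n * d ^+ n| <= B) /\
  ((fun N : nat => \sum_(n < N) c n * d ^+ n) @ \oo --> f d).

Lemma entire_poly (P : {poly Rl}) : entire (fun d => P.[d]).
Proof.
exists (fun n => P`_n) => d; split.
  exists (\sum_(n < size P) `|P`_n * d ^+ n|) => N.
  have [NP|/ltnW PN] := leqP N (size P).
    rewrite -!(big_mkord xpredT (fun n => `|P`_n * d ^+ n|)) (big_cat_nat (leq0n _) NP) //=.
    by rewrite lerDl sumr_ge0.
  rewrite -!(big_mkord xpredT (fun n => `|P`_n * d ^+ n|)) (big_cat_nat (leq0n _) PN) //=.
  rewrite [X in _ + X]big1_seq ?addr0 // => i /=.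
  by rewrite mem_index_iota => /andP[Pi _]; rewrite nth_default // mul0r normr0.
apply: cvg_near_cst; near=> N.
have PN : (size P <= N)%N by near: N; exists (size P).
rewrite horner_coef -!(big_mkord xpredT (fun n => P`_n * d ^+ n)) (big_cat_nat (leq0n _) PN) //=.
rewrite [X in _ + X]big1_seq ?addr0 // => i /=.
by rewrite mem_index_iota => /andP[Pi _]; rewrite nth_default // mul0r.
Unshelve. all: by end_near. Qed.

(** The exponential series of [|al * d|] dominates the absolute partial sums; the series of sine and
    cosine of [al * d] are of this kind. *)
Lemma entire_exp_bound (c : nat -> Rl) (al : Rl) (f : Rl -> Rl) :
  (forall n d, `|c n * d ^+ n| <= exp_coeff `|al * d| n) ->
  (forall d, (fun N : nat => \sum_(n < N) c n * d ^+ n) @ \oo --> f d) ->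
  entire f.
Proof.
move=> cb cf; exists c => d; split => //.
exists (limn (series (exp_coeff `|al * d|))) => N.
apply: le_trans (nondecreasing_cvgn_le _ (is_cvg_series_exp_coeff _) N).
  by rewrite /series /= big_mkord ler_sum.
by apply: nondecreasing_series => n _ _; rewrite divr_ge0 ?exprn_ge0.
Qed.

Lemma entire_sin (al : Rl) : entire (fun d => sin (al * d)).
Proof.
apply: (@entire_exp_bound (fun n => (odd n)%:R * (-1) ^+ n.-1./2 * al ^+ n / n`!%:R) al).
  move=> n d; rewrite /exp_coeff /= !normrM exprMn.
  rewrite normfV !normr_nat !normrX normrN normr1 expr1n mulr1.
  rewrite mulrAC -!mulrA; case: odd; first by rewrite mul1r.
  by rewrite !mul0r !mulr_ge0 // exprn_ge0.
move=> d; have := @is_cvg_series_sin_coeff _ (al * d).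
rewrite (_ : (fun N : nat => _) = series (sin_coeff (al * d))); first by rewrite unlock.
apply/funext => N; rewrite /series /= big_mkord; apply: eq_bigr => i _.
by rewrite /sin_coeff /= exprMn [in RHS]mulrA [RHS]mulrAC.
Qed.

Lemma entire_cos (al : Rl) : entire (fun d => cos (al * d)).
Proof.
apply: (@entire_exp_bound (fun n => (~~ odd n)%:R * (-1) ^+ n./2 * al ^+ n / n`!%:R) al).
  move=> n d; rewrite /exp_coeff /= !normrM exprMn.
  rewrite normfV !normr_nat !normrX normrN normr1 expr1n mulr1.
  rewrite mulrAC -!mulrA; case: odd; last by rewrite mul1r.
  by rewrite !mul0r !mulr_ge0 // exprn_ge0.
move=> d; have := @is_cvg_series_cos_coeff _ (al * d).
rewrite (_ : (fun N : nat => _) = series (cos_coeff (al * d))); first by rewrite unlock.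
apply/funext => N; rewrite /series /= big_mkord; apply: eq_bigr => i _.
by rewrite /cos_coeff /= exprMn [in RHS]mulrA [RHS]mulrAC.
Qed.

(** By distributivity the sum over a cube of multi-indices is a product of three one-variable sums,
    so bounds and limits multiply. The radius 1 is arbitrary, as the factors converge everywhere. *)
Lemma analytic_at_prod (f : 'I_3 -> Rl -> Rl) (x0 : 'cV[Rl]_3) :
  (forall i, entire (f i)) ->
  analytic_at (fun x => \prod_(i < 3) f i (x i 0 - x0 i 0)) x0.
Proof.
move=> /boolp.choice [c hc]; exists 1; split=> //.
exists (fun a => \prod_(i < 3) c i (a i)) => y _.
have E (N : nat) : \sum_(a : {ffun 'I_3 -> 'I_N})
    (\prod_(i < 3) c i (a i)) * mono (y - x0) (fun i => nat_of_ord (a i)) =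
    \prod_(i < 3) \sum_(n < N) c i n * (y i 0 - x0 i 0) ^+ n.
  rewrite bigA_distr_bigA; apply: eq_bigr => a _; rewrite /mono -big_split /=.
  by apply: eq_bigr => i _; rewrite !mxE.
have E' (N : nat) : \sum_(a : {ffun 'I_3 -> 'I_N})
    `|(\prod_(i < 3) c i (a i)) * mono (y - x0) (fun i => nat_of_ord (a i))| =
    \prod_(i < 3) \sum_(n < N) `|c i n * (y i 0 - x0 i 0) ^+ n|.
  rewrite bigA_distr_bigA; apply: eq_bigr => a _; rewrite /mono -big_split /= normr_prod.
  by apply: eq_bigr => i _; rewrite !mxE.
split.
  have /boolp.choice[B hB] : forall i, exists B : Rl, forall N : nat,
    \sum_(n < N) `|c i n * (y i 0 - x0 i 0) ^+ n| <= B by move=> i; exact: (hc i _).1.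
  exists (\prod_i B i) => N; rewrite E'; apply: ler_prod => i _.
  by rewrite sumr_ge0 //= hB.
apply: (@cvgn_ext (fun N => \prod_(i < 3) \sum_(n < N) c i n * (y i 0 - x0 i 0) ^+ n)).
  by move=> N; rewrite E.
rewrite !big_ord_recr big_ord0 /=.
apply: (@cvgn_ext (fun N => 1 * _ * _ * _)) => [N|].
  by rewrite !big_ord_recr big_ord0 /=.
by do !apply: Rl_cvgM; [exact: cvg_cst|exact: (hc _ _).2..].
Qed.

Local Close Scope classical_set_scope.

Lemma analytic_at_ext (f g : 'cV[Rl]_3 -> Rl) x0 :
  f =1 g -> analytic_at f x0 -> analytic_at g x0.
Proof. by move/funext->. Qed.

Lemma analytic_at_prod3 (f0 f1 f2 : Rl -> Rl) (k : Rl) (x0 : 'cV[Rl]_3) :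
  entire f0 -> entire f1 -> entire f2 ->
  analytic_at (fun x => k * (f0 (x 0 0 - x0 0 0) * f1 (x 1 0 - x0 1 0) * f2 (x 2 0 - x0 2 0))) x0.
Proof.
move=> e0 e1 e2; apply: analytic_atZ.
have e i : entire (nth f0 [:: f0; f1; f2] i).
  by case: i => [|[|[|i]]] //=; rewrite nth_nil.
apply: analytic_at_ext (analytic_at_prod (fun i : 'I_3 => nth f0 [:: f0; f1; f2] i) x0 (fun i => e i)) => x.
rewrite !big_ord_recl big_ord0 /= mulr1 mulrA.
by congr (f0 (x _ 0 - x0 _ 0) * f1 (x _ 0 - x0 _ 0) * f2 (x _ 0 - x0 _ 0)); apply/val_inj.
Qed.

Lemma analytic_at_cst (k : Rl) x0 : analytic_at (fun=> k) x0.
Proof.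
apply: analytic_at_ext (analytic_at_prod3 _ _ _ k x0 (entire_poly 1) (entire_poly 1) (entire_poly 1)) => x.
by rewrite !hornerC !mulr1.
Qed.

Lemma analytic_at_sum (I : Type) (r : seq I) (f : I -> 'cV[Rl]_3 -> Rl) x0 :
  (forall i, analytic_at (f i) x0) -> analytic_at (fun x => \sum_(i <- r) f i x) x0.
Proof.
move=> fi; elim: r => [|i r IHr].
  by apply: analytic_at_ext (analytic_at_cst 0 x0) => x; rewrite big_nil.
by apply: analytic_at_ext (analytic_atD _ _ _ (fi i) IHr) => x; rewrite big_cons.
Qed.

Lemma ord3 (Q : 'I_3 -> Prop) : Q 0 -> Q 1 -> Q 2 -> forall i, Q i.
Proof.
move=> Q0 Q1 Q2 [[|[|[|//]]] i3].
- by rewrite (_ : Ordinal i3 = 0) //; apply/val_inj.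
- by rewrite (_ : Ordinal i3 = 1) //; apply/val_inj.
- by rewrite (_ : Ordinal i3 = 2) //; apply/val_inj.
Qed.

Lemma sum3E (V : nmodType) (f : 'I_3 -> V) : \sum_i f i = f 0 + f 1 + f 2.
Proof.
rewrite !big_ord_recl big_ord0 addr0 addrA.
by congr (f _ + f _ + f _); apply/val_inj.
Qed.

Lemma analytic_at_coord (j : 'I_3) x0 : analytic_at (fun x => x j 0) x0.
Proof.
(* The product is the displacement [x j 0 - x0 j 0]; the constant restores the coordinate. *)
apply: analytic_at_ext (analytic_atD _ _ _ (analytic_at_prod (fun i => horner (if i == j then 'X else 1)) x0 (fun i => entire_poly _)) (analytic_at_cst (x0 j 0) x0)) => x /=.
rewrite (bigD1 j) //= eqxx hornerX big1 ?mulr1 ?subrK // => i /negPf->.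
by rewrite hornerC.
Qed.

Lemma analytic_at_linear (a : 'I_3 -> Rl) x0 :
  analytic_at (fun x => \sum_j a j * x j 0) x0.
Proof. by apply: analytic_at_sum => j; apply/analytic_atZ/analytic_at_coord. Qed.

(** The addition formulas give eight products of sines and cosines of single displacements, weighted
    by the values [C] and [S] at [x0]. *)
Lemma analytic_at_cos (a : 'I_3 -> Rl) (ph : Rl) x0 :
  analytic_at (fun x => cos (\sum_j a j * x j 0 + ph)) x0.
Proof.
pose C := cos (\sum_j a j * x0 j 0 + ph); pose S := sin (\sum_j a j * x0 j 0 + ph).
have ec j := entire_cos (a j); have es j := entire_sin (a j).
have D f g (hf : analytic_at f x0) (hg : analytic_at g x0) := analytic_atD f g x0 hf hg.
have p3 f0 f1 f2 k e0 e1 e2 := analytic_at_prod3 f0 f1 f2 k x0 e0 e1 e2.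
have cc := p3 _ _ _ C (ec 0) (ec 1) (ec 2).
have c1 := p3 _ _ _ (- C) (es 0) (es 1) (ec 2).
have c2 := p3 _ _ _ (- C) (es 0) (ec 1) (es 2).
have c3 := p3 _ _ _ (- C) (ec 0) (es 1) (es 2).
have s0 := p3 _ _ _ S (es 0) (es 1) (es 2).
have s1 := p3 _ _ _ (- S) (es 0) (ec 1) (ec 2).
have s2 := p3 _ _ _ (- S) (ec 0) (es 1) (ec 2).
have s3 := p3 _ _ _ (- S) (ec 0) (ec 1) (es 2).
have cs := D _ _ (D _ _ cc c1) (D _ _ c2 c3).
have ss := D _ _ (D _ _ s0 s1) (D _ _ s2 s3).
apply: analytic_at_ext (D _ _ cs ss) => x.
rewrite (_ : \sum_j a j * x j 0 + ph = (\sum_j a j * x0 j 0 + ph) +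
  (a 0 * (x 0 0 - x0 0 0) + a 1 * (x 1 0 - x0 1 0) + a 2 * (x 2 0 - x0 2 0))); last first.
  by rewrite !sum3E; ring.
rewrite trigo.cosD -/C -/S (trigo.cosD (_ + _)) (trigo.sinD (_ + _)).
by rewrite (trigo.cosD (_ * _)) (trigo.sinD (_ * _)); ring.
Qed.

Lemma analytic_at_sin (a : 'I_3 -> Rl) (ph : Rl) x0 :
  analytic_at (fun x => sin (\sum_j a j * x j 0 + ph)) x0.
Proof.
apply: analytic_at_ext (analytic_at_cos a (ph - pi / 2) x0) => x.
by rewrite addrA trigo.cosBpihalf.
Qed.

(** * Affine actions *)

Definition intM {K : pzRingType} {m n} (M : 'M[int]_(m, n)) : 'M[K]_(m, n) := map_mx intr M.
Definition ratM {m n} (M : 'M[rat]_(m, n)) : 'M[Rl]_(m, n) := map_mx ratr M.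

Lemma ratM_intM m n (M : 'M[int]_(m, n)) : ratM (intM M) = intM M.
Proof. by apply/matrixP => i j; rewrite !mxE ratr_int. Qed.

Lemma in_latticeP (x : 'cV[Rl]_3) :
  in_lattice x <-> exists k : 'cV[int]_3, x = intM k.
Proof.
split=> [xint|[k ->] i]; last by rewrite mxE intr_int.
exists (\col_i Num.floor (x i 0)); apply/colP => i; rewrite !mxE.
by apply/esym/eqP; rewrite -intrEfloor; exact: xint.
Qed.

(** Such a relation makes [tau] a root of a rational polynomial, which must then be zero. Exponents
    start at 1 so that [q] alone occupies the constant term. *)
Lemma tau_independent (tau : Rl) (n : nat) (u : 'I_n -> rat) (q : rat) :
  (forall P : {poly rat}, P != 0 -> (map_poly ratr P).[tau] != 0) ->
  \sum_i ratr (u i) * tau ^+ i.+1 = ratr q -> forall i, u i = 0.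
Proof.
move=> tauT E i; pose w k := oapp u 0 (insub k : option 'I_n).
pose P := \poly_(k < n) w k * 'X - q%:P.
have : (map_poly ratr P).[tau] = 0.
  rewrite /P rmorphB rmorphM /= map_polyX map_polyC !hornerE.
  apply/eqP; rewrite subr_eq0; apply/eqP; apply: etrans _ E.
  rewrite (@horner_coef_wide _ n) ?mulr_suml; last first.
    by rewrite size_map_poly size_poly.
  apply: eq_bigr => k _.
  by rewrite coef_map coef_poly ltn_ord /= /w valK /= exprSr mulrA.
have [P0 _|/tauT/eqP//] := eqVneq P 0.
have := congr1 (fun Q : {poly rat} => Q`_i.+1) P0.
by rewrite coefB coefMX coefC /= subr0 coef0 coef_poly ltn_ord /w valK.
Qed.

Lemma real_analytic_affine (M : 'M[Rl]_3) (b : 'cV[Rl]_3) :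
  real_analytic (fun x => M *m x + b).
Proof.
move=> i x0.
apply: (analytic_at_ext _ _ _ _ (analytic_atD _ _ _ (analytic_at_linear (M i) x0) (analytic_at_cst (b i 0) x0))).
by move=> x; rewrite !mxE.
Qed.

(** The cocycle rule makes the lifts compose exactly, not just modulo the lattice. Multiplying a
    fixed-point equation by [v], which may depend on [l], cancels [x] and leaves a rational relation
    between powers of [tau]. *)
Lemma free_affine_action (p n : nat) (A : 'cV[int]_p -> 'M[int]_3)
    (B : 'I_n -> 'cV[int]_p -> 'cV[rat]_3) :
  A 0 = 1%:M -> (forall l m : 'cV[int]_p, A (l + m) = A l *m A m) ->
  (forall j (l m : 'cV[int]_p), B j (l + m) = B j l + intM (A l) *m B j m) ->
  (forall l : 'cV[int]_p, l != 0 -> exists v : 'rV[rat]_3,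
      v *m intM (A l) = v /\ exists j, v *m B j l != 0) ->
  exists F, torus_action F /\ free_action F /\ induces F A.
Proof.
move=> A0 AD BD hfree; have [tau tauT] := transcendental_exists.
pose b (l : 'cV[int]_p) : 'cV[Rl]_3 := \sum_(j < n) tau ^+ j.+1 *: ratM (B j l).
pose F (l : 'cV[int]_p) (x : 'cV[Rl]_3) := intM (A l) *m x + b l.
have B0 j : B j 0 = 0.
  have := BD j 0 0; rewrite addr0 A0 /intM map_mx1 mul1mx => /eqP.
  by rewrite -subr_eq0 opprD addrA subrr sub0r oppr_eq0 => /eqP.
have bD l m : b (l + m) = b l + intM (A l) *m b m.
  rewrite /b mulmx_sumr -big_split; apply: eq_bigr => j _ /=.
  by rewrite BD /ratM map_mxD map_mxM -/(ratM (intM _)) ratM_intM -scalemxAr scalerDr.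
exists F; split; first split.
- move=> x; suff -> : F 0 x - x = intM 0 by apply/in_latticeP; exists 0.
  rewrite /F /b A0 big1 => [|j _]; last by rewrite B0 /ratM map_mx0 scaler0.
  by rewrite /intM map_mx1 mul1mx addr0 subrr map_mx0.
- split=> [l m x|l]; last exact: real_analytic_affine.
  apply/in_latticeP; exists 0; rewrite /F AD bD /intM map_mxM map_mx0 mulmxDr mulmxA.
  by apply/eqP; rewrite subr_eq0 -addrA [b l + _]addrC.
- split; last first.
    by move=> l x k; rewrite /F mulmxDr /intM map_mxM addrAC.
  move=> l /hfree[v [vA [j vB]]] x /in_latticeP[k Fk].
  have := congr1 (mulmx (ratM v)) Fk.
  rewrite /F mulmxBr mulmxDr mulmxA -(ratM_intM _ _ (A l)) -map_mxM vA -/(ratM v).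
  rewrite addrAC subrr add0r -ratM_intM -map_mxM mulmx_sumr.
  move/matrixP/(_ 0 0); rewrite summxE [RHS]mxE => E.
  have /(tau_independent tau _ (fun j => (v *m B j l) 0 0) _ tauT)/(_ j) vB0 :
      \sum_i ratr ((v *m B i l) 0 0) * tau ^+ i.+1 = ratr ((v *m intM k) 0 0).
    rewrite -E; apply: eq_bigr => i _.
    by rewrite -scalemxAr -map_mxM !mxE mulrC.
  by case/eqP: vB; apply/matrixP => i i'; rewrite !ord1 vB0 mxE.
Qed.

(** Cocycles may be written in rational coordinates where the action is [T]; [invmx P] carries them
    back. The finite type [J] allows options and pairs as labels of cocycles. *)
Lemma free_affine_action_conj (p : nat) (J : finType) (A : 'cV[int]_p -> 'M[int]_3)
    (T : 'cV[int]_p -> 'M[rat]_3) (P : 'M[rat]_3) (B : J -> 'cV[int]_p -> 'cV[rat]_3) :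
  A 0 = 1%:M -> (forall l m : 'cV[int]_p, A (l + m) = A l *m A m) ->
  P \in unitmx -> (forall l, P *m intM (A l) = T l *m P) ->
  (forall j (l m : 'cV[int]_p), B j (l + m) = B j l + T l *m B j m) ->
  (forall l : 'cV[int]_p, l != 0 -> exists v : 'rV[rat]_3,
      v *m T l = v /\ exists j, v *m B j l != 0) ->
  exists F, torus_action F /\ free_action F /\ induces F A.
Proof.
move=> A0 AD Pu PA BD hfree.
apply: (free_affine_action p #|J| A (fun j l => invmx P *m B (enum_val j) l)) => //.
  move=> j l m; rewrite BD mulmxDr; congr (_ + _).
  by rewrite -[in RHS](mulKmx Pu (intM _)) PA !mulmxA mulmxK.
move=> l /hfree[v [vT [j vB]]]; exists (v *m P); split.
  by rewrite -mulmxA PA mulmxA vT.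
by exists (enum_rank j); rewrite enum_rankK mulmxA mulmxK.
Qed.

(** * Actions with a common fixed row and a common fixed column *)

Definition lin {p : nat} (i : 'I_p) (l : 'cV[int]_p) : rat := (l i 0)%:~R.

Lemma linD p (i : 'I_p) l m : lin i (l + m) = lin i l + lin i m.
Proof. by rewrite /lin mxE intrD. Qed.

Lemma lin_neq0 p (l : 'cV[int]_p) : l != 0 -> exists i, lin i l != 0.
Proof.
move=> l0; apply/existsP; apply: contraNT l0; rewrite negb_exists => /forallP l0.
by apply/eqP/colP => i; have := l0 i; rewrite negbK intr_eq0 mxE => /eqP.
Qed.

Lemma fixed_pairing_action (p : nat) (A : 'cV[int]_p -> 'M[int]_3)
    (v : 'rV[rat]_3) (w : 'cV[rat]_3) :
  A 0 = 1%:M -> (forall l m : 'cV[int]_p, A (l + m) = A l *m A m) ->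
  (forall l, v *m intM (A l) = v) -> (forall l, intM (A l) *m w = w) ->
  v *m w != 0 ->
  exists F, torus_action F /\ free_action F /\ induces F A.
Proof.
move=> A0 AD vA Aw vw; apply: (free_affine_action p p A (fun i l => lin i l *: w)) => //.
  by move=> i l m; rewrite linD scalerDl -scalemxAr Aw.
move=> l /lin_neq0[i li]; exists v; split=> //; exists i.
by rewrite -scalemxAr scaler_eq0 negb_or li.
Qed.

Definition col3 {K : nmodType} (x y z : K) : 'cV[K]_3 := \col_i nth 0 [:: x; y; z] i.
Definition row3 {K : nmodType} (x y z : K) : 'rV[K]_3 := \row_i nth 0 [:: x; y; z] i.

(** The shape taken by a matrix with a fixed row and a fixed column that are orthogonal, in the
    basis of [tri_basis]. *)
Definition tri {K : pzRingType} (e a b c : K) : 'M[K]_3 :=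
  \matrix_(i, j) nth 0 (nth [::] [:: [:: 1; 0; 0]; [:: a; e; 0]; [:: c; b; 1]] i) j.

Lemma eq_cV3 (K : pzRingType) (u v : 'cV[K]_3) :
  u 0 0 = v 0 0 -> u 1 0 = v 1 0 -> u 2 0 = v 2 0 -> u = v.
Proof. by move=> e0 e1 e2; apply/colP; apply: ord3. Qed.

(** [free_affine_action_conj] read entry by entry. In the equation for a fixed row, [v0] cancels
    from the first entry and the third entry is automatic. *)
Lemma tri_action (p : nat) (J : finType) (A : 'cV[int]_p -> 'M[int]_3) (P : 'M[rat]_3)
    (e a b c : 'cV[int]_p -> rat) (B0 B1 B2 : J -> 'cV[int]_p -> rat) :
  A 0 = 1%:M -> (forall l m : 'cV[int]_p, A (l + m) = A l *m A m) ->
  P \in unitmx -> (forall l, P *m intM (A l) = tri (e l) (a l) (b l) (c l) *m P) ->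
  (forall j l m, B0 j (l + m) = B0 j l + B0 j m) ->
  (forall j l m, B1 j (l + m) = B1 j l + a l * B0 j m + e l * B1 j m) ->
  (forall j l m, B2 j (l + m) = B2 j l + c l * B0 j m + b l * B1 j m + B2 j m) ->
  (forall l : 'cV[int]_p, l != 0 -> exists v0 v1 v2,
      [/\ v1 * a l + v2 * c l = 0, v1 * e l + v2 * b l = v1 &
          exists j, v0 * B0 j l + v1 * B1 j l + v2 * B2 j l != 0]) ->
  exists F, torus_action F /\ free_action F /\ induces F A.
Proof.
move=> A0 AD Pu PA B0D B1D B2D hfree.
apply: (free_affine_action_conj p J A _ P (fun j l => col3 (B0 j l) (B1 j l) (B2 j l))) PA _ _ => //.
  by move=> j l m; apply: eq_cV3; rewrite !mxE sum3E !mxE /= ?B0D ?B1D ?B2D; ring.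
move=> l /hfree[v0 [v1 [v2 [va ve [j vB]]]]]; exists (row3 v0 v1 v2); split.
  apply/trmx_inj/eq_cV3; rewrite !mxE sum3E !mxE /= ?mulr0 ?mulr1 ?addr0 ?add0r //.
  by rewrite -addrA va addr0.
exists j; apply: contra vB => /eqP/matrixP/(_ 0 0).
by rewrite !mxE sum3E !mxE /= => ->.
Qed.

Lemma mulmx_tri (K : comPzRingType) (e a b c e' a' b' c' : K) :
  tri e a b c *m tri e' a' b' c' =
  tri (e * e') (a + e * a') (b * e' + b') (c + b * a' + c').
Proof.
apply/matrixP => i j; rewrite !mxE sum3E !mxE.
case: i => [[|[|[|//]]] i3]; case: j => [[|[|[|//]]] j3]; rewrite /=; ring.
Qed.

Lemma tri_inj (K : comPzRingType) (e a b c e' a' b' c' : K) :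
  tri e a b c = tri e' a' b' c' -> [/\ e = e', a = a', b = b' & c = c'].
Proof.
move/matrixP => E; split; [have := E 1 1|have := E 1 0|have := E 2 1|have := E 2 0];
  by rewrite !mxE.
Qed.

(** The rows of [P] are [v], a second vector [u] of the plane of rows killed by [w], and some [y]
    with [y w = 1]. As [g] fixes [w], both [u g] and [y g - y] lie in that plane. *)
Lemma tri_basis (K : fieldType) (v : 'rV[K]_3) (w : 'cV[K]_3) :
  v != 0 -> w != 0 -> v *m w = 0 ->
  exists2 P : 'M[K]_3, P \in unitmx &
    forall g : 'M[K]_3, v *m g = v -> g *m w = w ->
      exists e a b c, P *m g = tri e a b c *m P.
Proof.
move=> v0 w0 vw; pose N := kermx w.
have rN : \rank N = 2 by rewrite mxrank_ker -mxrank_tr rank_rV trmx_eq0 w0.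
have vN : (v <= N)%MS by apply/sub_kermxP.
have [i ui] : exists i, ~~ (row i N <= v)%MS.
  apply/row_subPn; apply/negP => /mxrankS; rewrite rN rank_rV v0; lia.
pose u := row i N; have uw : u *m w = 0 by apply/sub_kermxP; rewrite row_sub.
have span (x : 'rV[K]_3) : x *m w = 0 -> exists s t, x = s *: v + t *: u.
  move=> xw; have NU : (N <= v + u)%MS.
    have uvN : (v + u <= N)%MS by rewrite addsmx_sub vN row_sub.
    rewrite -(mxrank_leqif_sup uvN) rN eqn_leq -{1}rN mxrankS //=.
    have : (v < v + u)%MS by rewrite /ltmx addsmxSl addsmx_sub submx_refl /= ui.
    by rewrite ltmxErank rank_rV v0 => /andP[].
  have /sub_addsmxP[[s t] /= ->] : (x <= v + u)%MS.
    by apply: submx_trans NU; apply/sub_kermxP.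
  exists (s 0 0), (t 0 0).
  by rewrite [s in LHS]mx11_scalar [t in LHS]mx11_scalar !mul_scalar_mx.
have [k wk] : exists k, w k 0 != 0.
  apply/existsP; apply: contraNT w0; rewrite negb_exists => /forallP w0.
  by apply/eqP/colP => k; have := w0 k; rewrite negbK mxE => /eqP.
have [y yw] : exists y : 'rV[K]_3, y *m w = 1%:M.
  exists ((w k 0)^-1 *: delta_mx 0 k); rewrite -scalemxAl -rowE.
  by apply/matrixP => s t; rewrite !ord1 !mxE mulVf.
pose r (i : 'I_3) : 'rV[K]_3 := nth 0 [:: v; u; y] i.
have mulP (x : 'rV[K]_3) : x *m \matrix_i r i = x 0 0 *: v + x 0 1 *: u + x 0 2 *: y.
  by rewrite mulmx_sum_row sum3E !rowK.
exists (\matrix_i r i).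
  rewrite -row_free_unit; apply: inj_row_free => x; rewrite mulP => x0.
  have x2 : x 0 2 = 0.
    have := congr1 (mulmx^~ w) x0; rewrite !mulmxDl -!scalemxAl vw uw yw mul0mx !scaler0 !add0r.
    by move/matrixP/(_ 0 0); rewrite !mxE mulr1.
  have x1 : x 0 1 = 0.
    apply: contraNeq ui => x1; apply/sub_rVP; exists (- x 0 0 / x 0 1).
    move: x0; rewrite x2 scale0r addr0 => /eqP; rewrite addrC addr_eq0 => /eqP x1u.
    by rewrite mulrC -scalerA scaleNr -x1u scalerA mulVf // scale1r.
  have {}x0 : x 0 0 = 0.
    by move/eqP: x0; rewrite x2 x1 !scale0r !addr0 scaler_eq0 (negPf v0) orbF => /eqP.
  by apply/trmx_inj/eq_cV3; rewrite !mxE.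
move=> g vg gw.
have [|a [e ug]] := span (u *m g); first by rewrite -mulmxA gw.
have [|c [b yg]] := span (y *m g - y); first by rewrite mulmxBl -mulmxA gw subrr.
exists e, a, b, c; apply/row_matrixP => j; rewrite !row_mul rowK mulP !mxE.
case: j => [[|[|[|//]]] j3]; rewrite /r /=.
- by rewrite vg scale1r !scale0r !addr0.
- by rewrite ug scale0r addr0.
- by rewrite scale1r -yg subrK.
Qed.

(** In triangular form [e] is a character, and [a], [b], [c] satisfy the rules [TD]. Each case
    builds cocycles from polynomials in these entries and from the coordinates of [l], so that for
    every nonzero [l] a fixed row detects one of them. *)
Lemma fixed_orthogonal_action (p : nat) (A : 'cV[int]_p -> 'M[int]_3)
    (v : 'rV[rat]_3) (w : 'cV[rat]_3) :
  A 0 = 1%:M -> (forall l m : 'cV[int]_p, A (l + m) = A l *m A m) ->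
  (forall l, v *m intM (A l) = v) -> (forall l, intM (A l) *m w = w) ->
  v != 0 -> w != 0 -> v *m w = 0 ->
  exists F, torus_action F /\ free_action F /\ induces F A.
Proof.
move=> A0 AD vA Aw v0 w0 vw.
have [P Pu PT] := tri_basis _ v w v0 w0 vw.
have /choice[e /choice[a /choice[b /choice[c PA]]]] :
  forall l, exists e a b c, P *m intM (A l) = tri e a b c *m P.
  by move=> l; exact: PT.
have TD l m : [/\ e (l + m) = e l * e m, a (l + m) = a l + e l * a m,
    b (l + m) = b l * e m + b m & c (l + m) = c l + b l * a m + c m].
  apply: tri_inj; rewrite -mulmx_tri; apply: (can_inj (mulmxK Pu)).
  by rewrite -PA AD /intM map_mxM mulmxA PA -mulmxA PA mulmxA.
have eD l m : e (l + m) = e l * e m by case: (TD l m).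
have aD l m : a (l + m) = a l + e l * a m by case: (TD l m).
have bD l m : b (l + m) = b l * e m + b m by case: (TD l m).
have cD l m : c (l + m) = c l + b l * a m + c m by case: (TD l m).
(* By commutativity, [a] and [b] are proportional to [e - 1] when [e] is
   nontrivial; when [e = 1], [comm] below makes [a] and [b] proportional, up to
   one of them being zero. *)
have act := tri_action p _ A P e a b c _ _ _ A0 AD Pu PA.
have [[m em]|/forallNP e1'] := pselect (exists m, e m != 1).
  pose s := a m / (e m - 1); pose r := b m / (e m - 1).
  have em0 : e m - 1 != 0 by rewrite subr_eq0.
  have aE l : a l = s * (e l - 1).
    have := aD l m; rewrite addrC aD => E; apply: (mulIf em0).
    rewrite /s mulrAC divfK //; lra.
  have bE l : b l = r * (e l - 1).
    have := bD l m; rewrite addrC bD => E; apply: (mulIf em0).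
    rewrite /r mulrAC divfK //; lra.
  (* The subtracted term has the same defect of additivity as [c], so [h] is a homomorphism. *)
  pose h l := c l - r * s * (e l - 1).
  have hD l l' : h (l + l') = h l + h l'.
    by rewrite /h cD eD aE bE; ring.
  (* The row [(1, 0, 0)] is always fixed and detects [h l]. When [h l = 0], the row [(0, - r, 1)] is
     fixed and detects a coordinate of [l]. *)
  apply: (act (option 'I_p) (fun i l => if i is Some _ then 0 else h l)
    (fun i l => if i is Some _ then 0 else - s * h l)
    (fun i l => if i is Some i then lin i l else h l ^+ 2 / 2)).
  - by case=> [i|] l l' //; rewrite ?hD ?addr0.
  - by case=> [i|] l l'; rewrite ?hD ?aE; [ring|field].
  - case=> [i|] l l'; rewrite ?linD ?hD ?bE; first ring.
    by rewrite [c l](_ : _ = h l + r * s * (e l - 1)) ?/h; field.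
  move=> l /lin_neq0[i li]; have [hl|hl] := eqVneq (h l) 0.
    exists 0, (- r), 1; split; last by exists (Some i); rewrite !mulr0 !add0r mul1r.
      by rewrite aE; move: hl; rewrite /h; lra.
    by rewrite bE; ring.
  exists 1, 0, 0; split; [ring|ring|exists None].
  by rewrite mul1r !mul0r !addr0.
have {}e1' l : e l = 1 by apply/eqP/negPn/negP.
have {}aD l m : a (l + m) = a l + a m by rewrite aD e1' mul1r.
have {}bD l m : b (l + m) = b l + b m by rewrite bD e1' mulr1.
have [a0|/existsNP[m /eqP am]] := pselect (forall l, a l = 0).
  have {}cD l m : c (l + m) = c l + c m by rewrite cD a0 mulr0 addr0.
  (* The first two rows of the standard basis are fixed and detect [c l] and [b l]; when both vanish
     the third is fixed too and detects a coordinate. *)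
  apply: (act (option 'I_p) (fun i l => if i is Some _ then 0 else c l)
    (fun i l => if i is Some _ then 0 else b l)
    (fun i l => if i is Some i then lin i l else (c l ^+ 2 + b l ^+ 2) / 2)).
  - by case=> [i|] l l' //; rewrite ?cD ?addr0.
  - by case=> [i|] l l'; rewrite ?bD ?a0 ?e1'; ring.
  - by case=> [i|] l l'; rewrite ?linD ?cD ?bD; [ring|field].
  move=> l /lin_neq0[i li]; have [cl|cl] := eqVneq (c l) 0; last first.
    exists 1, 0, 0; split; [ring|ring|exists None].
    by rewrite mul1r !mul0r !addr0.
  have [bl|bl] := eqVneq (b l) 0; last first.
    exists 0, 1, 0; rewrite a0 e1'; split; [ring|ring|exists None].
    by rewrite mul1r !mul0r add0r addr0.
  exists 0, 0, 1; rewrite bl cl; split; [ring|ring|exists (Some i)].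
  by rewrite mul1r !mul0r !add0r.
have comm l l' : b l * a l' = b l' * a l.
  by have := cD l l'; rewrite addrC cD; lra.
have [b0|/existsNP[m' /eqP bm]] := pselect (forall l, b l = 0).
  (* The fixed row used is [(0, 1, 0)] when [a l = 0] and [(0, c l, - a l)] otherwise. *)
  apply: (act ('I_p * bool)%type (fun=> fun=> 0)
    (fun i l => if i.2 then lin i.1 l else 0) (fun i l => if i.2 then 0 else lin i.1 l)).
  - by move=> *; rewrite addr0.
  - by case=> i [] l l' /=; rewrite ?linD ?e1'; ring.
  - by case=> i [] l l' /=; rewrite ?linD ?b0; ring.
  move=> l /lin_neq0[i li]; have [al|al] := eqVneq (a l) 0.
    exists 0, 1, 0; rewrite al e1'; split; [ring|ring|exists (i, true)].
    by rewrite /= mul1r !mul0r add0r addr0.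
  exists 0, (c l), (- a l); rewrite b0 e1'; split; [ring|ring|exists (i, false)].
  by rewrite /= !(mulr0, mul0r) !add0r mulf_neq0 ?oppr_eq0.
pose k := b m / a m.
have bE l : b l = k * a l by rewrite /k mulrAC -comm mulfK.
have k0 : k != 0 by apply: contraNneq bm => k0; rewrite bE k0 mul0r.
(* The cocycle [None] extends the homomorphism [a]. Its first entry settles [a l <> 0], its second
   settles [a l = 0] with [c l <> 0]; otherwise the matrix is the identity and a coordinate is
   detected. *)
apply: (act (option 'I_p) (fun i l => if i is Some _ then 0 else a l)
  (fun i l => if i is Some _ then 0 else c l / k)
  (fun i l => if i is Some i then lin i l else a l * c l - k * a l ^+ 3 / 3)).
- by case=> [i|] l l' //; rewrite ?aD ?addr0.
- by case=> [i|] l l'; rewrite ?cD ?bE ?e1'; [ring|field].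
- by case=> [i|] l l'; rewrite ?linD ?aD ?cD ?bE; [ring|field].
move=> l /lin_neq0[i li]; have [al|al] := eqVneq (a l) 0; last first.
  exists 1, 0, 0; split; [ring|ring|exists None].
  by rewrite mul1r !mul0r !addr0.
have [cl|cl] := eqVneq (c l) 0; last first.
  exists 0, 1, 0; rewrite al e1'; split; [ring|ring|exists None].
  by rewrite mul1r !mul0r add0r addr0 mulf_neq0 ?invr_eq0.
exists 0, 0, 1; rewrite bE al cl; split; [ring|ring|exists (Some i)].
by rewrite mul1r !mul0r !add0r.
Qed.

(** * Commuting families with eigenvalue one *)

Section CommutingFamily.
Context {K : fieldType} {n : nat} {T : Type} (g : T -> 'M[K]_n).

(** Subspaces are row spaces of square matrices, with [g s] acting on the right. *)
Definition stable_family (U : 'M[K]_n) := forall s, (U *m g s <= U)%MS.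

Definition simple_family (U : 'M[K]_n) := [/\ U != 0, stable_family U &
  forall W, stable_family W -> (W <= U)%MS -> W != 0 -> (U <= W)%MS].

Lemma simple_family_exists (E : 'M[K]_n) : stable_family E -> E != 0 ->
  exists2 U, simple_family U & (U <= E)%MS.
Proof.
have [r] := ubnP (\rank E); elim: r E => // r IHr E ltEr stE E0.
have [min|] := pselect (forall W, stable_family W -> (W <= E)%MS -> W != 0 -> (E <= W)%MS).
  by exists E.
move=> /existsNP[W /not_implyP[stW /not_implyP[WE /not_implyP[W0 /negP nEW]]]].
have [|//|//|U sU UW] := IHr W; last by exists U => //; apply: submx_trans WE.
apply: leq_trans _ (ltnSE ltEr); rewrite ltn_neqAle mxrankS // andbT.
by apply: contra nEW; rewrite (mxrank_leqif_sup WE).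
Qed.

Context (gC : forall s t, g s *m g t = g t *m g s).

Lemma stable_family_ker s : stable_family (kermx (g s - 1%:M)).
Proof.
move=> t; apply/sub_kermxP; rewrite -mulmxA.
have -> : g t *m (g s - 1%:M) = (g s - 1%:M) *m g t.
  by rewrite mulmxBr mulmxBl gC mulmx1 mul1mx.
by rewrite mulmxA mulmx_ker mul0mx.
Qed.

(** Commutativity makes the fixed space of [g s] stable, so by minimality it contains [U] or meets
    it trivially. *)
Lemma simple_family_fix U s : simple_family U ->
  U *m g s = U \/ (U :&: kermx (g s - 1%:M))%MS = 0.
Proof.
move=> [U0 stU minU]; have [->|W0] := eqVneq (U :&: kermx (g s - 1%:M))%MS 0; first by right.
left; have /minU/(_ (capmxSl _ _) W0) : stable_family (U :&: kermx (g s - 1%:M))%MS.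
  move=> t; rewrite sub_capmx (submx_trans _ (stU t)) ?submxMr ?capmxSl //=.
  by rewrite (submx_trans _ (stable_family_ker s t)) ?submxMr ?capmxSr.
rewrite sub_capmx submx_refl /= => /sub_kermxP/eqP.
by rewrite mulmxBr mulmx1 subr_eq0 => /eqP.
Qed.

Lemma fixedP m (x : 'M[K]_(m, n)) s : reflect (x *m g s = x) (x <= kermx (g s - 1%:M))%MS.
Proof.
apply: (iffP sub_kermxP); rewrite mulmxBr mulmx1; last by move->; rewrite subrr.
by move/eqP; rewrite subr_eq0 => /eqP.
Qed.

(** In a direct sum of stable subspaces, the components of a fixed vector are fixed: the
    displacement of the first lies in both summands. *)
Lemma addsmx_fixed0 U V s : stable_family U -> stable_family V ->
  (U :&: V)%MS = 0 -> (U :&: kermx (g s - 1%:M))%MS = 0 ->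
  (V :&: kermx (g s - 1%:M))%MS = 0 -> ((U + V) :&: kermx (g s - 1%:M))%MS = 0.
Proof.
move=> stU stV UV0 U0 V0; apply/eqP/rowV0P => x.
rewrite sub_capmx => /andP[/sub_addsmxP[[a b] /= ->] /fixedP xs].
have cap0 (W Z : 'M[K]_n) (y : 'rV_n) : (W :&: Z)%MS = 0 ->
    (y <= W)%MS -> (y <= Z)%MS -> y = 0.
  by move=> WZ yW yZ; apply/eqP; rewrite -submx0 -WZ sub_capmx yW.
have E : a *m U *m g s - a *m U = b *m V - b *m V *m g s.
  have := xs; rewrite mulmxDl => /(canRL (addrK _))->.
  by rewrite addrAC [_ + b *m V - _]addrAC subrr add0r.
have Us : (a *m U *m g s - a *m U <= U)%MS.
  by rewrite addmx_sub ?eqmx_opp ?submxMl // -mulmxA mulmx_sub.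
have Vs : (a *m U *m g s - a *m U <= V)%MS.
  by rewrite E addmx_sub ?eqmx_opp ?submxMl // -mulmxA mulmx_sub.
have D0 := cap0 _ _ _ UV0 Us Vs.
have -> : a *m U = 0.
  by apply: (cap0 _ _ _ U0); rewrite ?submxMl //; apply/fixedP/eqP; rewrite -subr_eq0 D0.
have -> : b *m V = 0.
  apply: (cap0 _ _ _ V0); rewrite ?submxMl //; apply/fixedP/esym/eqP.
  by rewrite -subr_eq0 -E D0.
by rewrite addr0.
Qed.

End CommutingFamily.

(** Without a common fixed row, a simple [U] has no vector fixed by some [h], and a simple [V]
    inside the fixed space of [h] has none fixed by some [h']. Then some [k] fixes no nonzero vector
    of [U + V], and its own fixed space is a third independent stable subspace. In dimension 3 all
    three are lines. *)
Lemma fixed_row_or_diag {K : fieldType} {T : Type} (g : T -> 'M[K]_3) :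
  (forall s t, g s *m g t = g t *m g s) ->
  (forall s t, exists r, g r = g s *m g t) ->
  (forall s, eigenvalue (g s) 1) ->
  (exists2 v : 'rV[K]_3, v != 0 & forall s, v *m g s = v) \/
  (exists2 P : 'M[K]_3, P \in unitmx &
     exists d : T -> 'rV[K]_3, forall s, P *m g s = diag_mx (d s) *m P).
Proof.
move=> gC gM g1.
have ker0 s : kermx (g s - 1%:M) != 0 by have := g1 s.
have nofix (U : 'M[K]_3) : simple_family g U ->
    (exists2 v : 'rV[K]_3, v != 0 & forall s, v *m g s = v) \/
    (exists s, (U :&: kermx (g s - 1%:M))%MS = 0).
  move=> sU; have [U0 _ _] := sU.
  have [fixU|/existsNP[s Us]] := pselect (forall s, U *m g s = U); last first.
    by right; exists s; case: (simple_family_fix g gC U s sU).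
  left; exists (nz_row U); first by rewrite nz_row_eq0.
  move=> s; have /submxP[a ->] := nz_row_sub U.
  by rewrite -mulmxA fixU.
have stE := stable_family_ker g gC.
have [|//|U sU _] := simple_family_exists g 1%:M; first by move=> s; rewrite submx1.
  by rewrite -mxrank_eq0 mxrank1.
have [|[h Uh]] := nofix U sU; first by left.
have [V sV Vh] := simple_family_exists g _ (stE h) (ker0 h).
have [|[h' Vh']] := nofix V sV; first by left.
have [U0 stU minU] := sU; have [V0 stV minV] := sV.
have UV0 : (U :&: V)%MS = 0 by apply/eqP; rewrite -submx0 -Uh capmxS.
have Vfix : V *m g h = V by apply/fixedP.
(* Take [h'] if it fixes no nonzero vector of [U]. Otherwise it fixes all of [U], and the product of
   [h] and [h'] acts on [U] as [h] and on [V] as [h']. *)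
have [k UVk] : exists k, ((U + V) :&: kermx (g k - 1%:M))%MS = 0.
  have [Ufix'|Uh'] := simple_family_fix g gC U h' sU; last first.
    by exists h'; apply: addsmx_fixed0.
  have [k gk] := gM h h'; exists k; apply: addsmx_fixed0 => //.
    apply/eqP/rowV0P => x; rewrite sub_capmx => /andP[xU /fixedP xk].
    apply/eqP; rewrite -submx0 -Uh sub_capmx xU; apply/fixedP.
    rewrite -{2}xk gk mulmxA; have /submxP[a ->] : (x *m g h <= U)%MS.
      by apply: submx_trans (stU h); rewrite submxMr.
    by rewrite -mulmxA Ufix'.
  apply/eqP/rowV0P => x; rewrite sub_capmx => /andP[xV /fixedP xk].
  apply/eqP; rewrite -submx0 -Vh' sub_capmx xV; apply/fixedP.
  by have /submxP[a xa] := xV; rewrite -{2}xk gk mulmxA xa -[a *m V *m g h]mulmxA Vfix.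
right; set E := kermx _ in UVk; have E0 : E != 0 := ker0 k.
have r3 : (\rank U + \rank V + \rank E <= 3)%N.
  by rewrite -(mxrank_disjoint_sum UV0) -(mxrank_disjoint_sum UVk) rank_leq_col.
move: (U0) (V0) (E0); rewrite -!mxrank_eq0 -!lt0n => rU rV rE.
have line (W : 'M[K]_3) : stable_family g W -> W != 0 -> (\rank W <= 1)%N ->
    (W <= nz_row W)%MS /\ forall s, exists a, nz_row W *m g s = a *: nz_row W.
  move=> stW W0 rW.
  have Ww : (W <= nz_row W)%MS.
    by rewrite -(mxrank_leqif_sup (nz_row_sub W)) eqn_leq mxrankS ?nz_row_sub //= rank_rV nz_row_eq0 W0.
  split=> // s; apply/sub_rVP; apply: submx_trans Ww.
  by apply: submx_trans (stW s); rewrite submxMr // nz_row_sub.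
have [|Uu lU] := line U stU U0; first by lia.
have [|Vv lV] := line V stV V0; first by lia.
have [|Ee lE] := line E (stE k) E0; first by lia.
pose w (i : 'I_3) : 'rV[K]_3 := nth 0 [:: nz_row U; nz_row V; nz_row E] i.
have lw (i : 'I_3) s : exists a, w i *m g s = a *: w i.
  by case: i => [[|[|[|]]]].
exists (\matrix_i w i).
  rewrite -row_free_unit -row_leq_rank.
  apply: (@leq_trans (\rank U + \rank V + \rank E)); first by lia.
  rewrite -(mxrank_disjoint_sum UV0) -(mxrank_disjoint_sum UVk) mxrankS // !addsmx_sub.
  have sub (i : 'I_3) : (w i <= \matrix_i w i)%MS by rewrite -[w i](rowK w) row_sub.
  apply/andP; split; first (apply/andP; split).
  - exact: submx_trans Uu (sub 0).
  - exact: submx_trans Vv (sub 1).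
  - exact: submx_trans Ee (sub 2).
have /choice[d hd] : forall s, exists d : 'rV[K]_3, forall i, w i *m g s = d 0 i *: w i.
  move=> s; have /choice[a ha] := lw ^~ s.
  by exists (\row_i a i) => i; rewrite mxE.
exists d => s; apply/row_matrixP => i.
by rewrite !row_mul rowK hd row_diag_mx -scalemxAl -rowE rowK.
Qed.

(** * The Klein case *)

Lemma periodicz (U V : zmodType) (f : U -> V) (T : U) :
  periodic f T -> forall (N : int) x, f (x + T *~ N) = f x.
Proof.
move=> fT [n|n] x; first by rewrite -pmulrn periodicn.
by rewrite -[in RHS](subrK (T *+ n.+1) x) periodicn // NegzE mulrNz -pmulrn.
Qed.

Lemma sin_pi_int (R : realType) (N : int) : sin (N%:~R * pi) = 0 :> R.
Proof.
have s (n : nat) : sin (pi *+ n) = 0 :> R.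
  by rewrite -[pi *+ n]add0r (alternatingn (@sinDpi R)) sin0 mulr0.
by case: N => n; rewrite ?NegzE ?mulrNz ?mulNr ?sinN -?pmulrn mulr_natl s ?oppr0.
Qed.

(** [k] is the parity of the number of half-turns, and [1 - 2 * k] the resulting sign. *)
Lemma cos_half_turns (R : realType) (k N : int) (x : R) : k = 0 \/ k = 1 ->
  cos (x + (k + 2 * N)%:~R * pi) = (1 - 2 * k)%:~R * cos x.
Proof.
move=> k01; rewrite intrD intrM mulrDl addrA.
rewrite (_ : 2%:~R * N%:~R * pi = (pi *+ 2) *~ N); last first.
  by rewrite -mulrzl -[pi *+ 2]mulr_natl; ring.
rewrite (periodicz _ _ _ _ (@cosD2pi R)).
case: k01 => ->; first by rewrite mulr0 subr0 mul0r addr0 mul1r.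
by rewrite mul1r cosDpi mulr1 (_ : 1 - 2 = -1 :> int) // mulrN1z mulN1r.
Qed.

Lemma sin_half_turns (R : realType) (k N : int) (x : R) : k = 0 \/ k = 1 ->
  sin (x + (k + 2 * N)%:~R * pi) = (1 - 2 * k)%:~R * sin x.
Proof.
move=> k01; rewrite intrD intrM mulrDl addrA.
rewrite (_ : 2%:~R * N%:~R * pi = (pi *+ 2) *~ N); last first.
  by rewrite -mulrzl -[pi *+ 2]mulr_natl; ring.
rewrite (periodicz _ _ _ _ (@sinD2pi R)).
case: k01 => ->; first by rewrite mulr0 subr0 mul0r addr0 mul1r.
by rewrite mul1r sinDpi mulr1 (_ : 1 - 2 = -1 :> int) // mulrN1z mulN1r.
Qed.

(** The sum is [Q] at [tau] with [Q] divisible by ['X]. If its square were [q], then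
    [Q ^+ 2 = q%:P]; evaluation at 0 gives [q = 0], hence [Q = 0]. *)
Lemma tau_sqr_irrational (tau : Rl) (p : nat) (l : 'cV[int]_p) :
  (forall P : {poly rat}, P != 0 -> (map_poly ratr P).[tau] != 0) -> l != 0 ->
  forall q : rat, (\sum_i (l i 0)%:~R * tau ^+ i.+1) ^+ 2 <> ratr q.
Proof.
move=> tauT /lin_neq0[i li] q.
pose w k := oapp (fun j => lin j l) 0 (insub k : option 'I_p).
pose Q := \poly_(k < p) w k * 'X.
have -> : \sum_i (l i 0)%:~R * tau ^+ i.+1 = (map_poly ratr Q).[tau].
  rewrite /Q rmorphM /= map_polyX hornerMX.
  rewrite (@horner_coef_wide _ p) ?mulr_suml; last by rewrite size_map_poly size_poly.
  apply: eq_bigr => k _.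
  by rewrite coef_map coef_poly ltn_ord /= /w valK /= exprSr mulrA ratr_int.
move=> E; have Q2 : Q ^+ 2 - q%:P = 0.
  apply/eqP; apply: contraT => /tauT/eqP[].
  rewrite rmorphB rmorphXn /= map_polyC !hornerE; apply/eqP; rewrite subr_eq0; apply/eqP.
  exact: E.
have q0 : q = 0.
  have := congr1 (horner^~ 0) Q2.
  rewrite hornerD hornerN hornerC horner_exp /Q hornerMX mulr0 expr2 mulr0 horner0.
  by move=> /eqP; rewrite sub0r oppr_eq0 => /eqP.
move: Q2; rewrite q0 subr0 => /eqP; rewrite expf_eq0 /= => /eqP Q0.
have := congr1 (fun S : {poly rat} => S`_i.+1) Q0.
rewrite coefMX /= coef0 coef_poly ltn_ord /w valK /= => li0.
by rewrite li0 eqxx in li.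
Qed.

(** A sign character is determined on the standard basis, so it is -1 to the power of an integer
    homomorphism [c]; [k] and [N] are the remainder and quotient of [c] by 2. *)
Lemma sign_lift (p : nat) (chi : 'cV[int]_p -> rat) :
  (forall l m, chi (l + m) = chi l * chi m) -> (forall l, chi l = 1 \/ chi l = -1) ->
  exists c k N : 'cV[int]_p -> int, [/\ forall l m, c (l + m) = c l + c m,
    forall l, c l = k l + 2 * N l, forall l, k l = 0 \/ k l = 1 &
    forall l, chi l = (1 - 2 * k l)%:~R].
Proof.
move=> chiM chi1.
have chi0 : chi 0 = 1.
  have := chiM 0 0; rewrite addr0.
  by case: (chi1 0) => -> //; rewrite mulrNN mulr1 => /eqP.
have chi_neq0 l : chi l != 0 by case: (chi1 l) => ->.
have chiN l : chi (- l) = (chi l)^-1.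
  by apply: (mulIf (chi_neq0 l)); rewrite -chiM addNr chi0 mulVf.
have chiXn l (n : nat) : chi (l *+ n) = chi l ^+ n.
  by elim: n => [|n IHn]; rewrite ?mulr0n ?mulrS ?exprS ?chiM ?IHn.
have chiX l (n : int) : chi (l *~ n) = chi l ^ n.
  by case: n => n; rewrite ?NegzE ?mulrNz ?chiN -?pmulrn chiXn // exprzN.
pose a i : int := if chi (delta_mx i 0) == 1 then 0 else 1.
pose c (l : 'cV[int]_p) := \sum_i a i * l i 0.
exists c, (fun l => (c l %% 2)%Z), (fun l => (c l %/ 2)%Z); split.
- by move=> l m; rewrite -big_split; apply: eq_bigr => i _; rewrite mxE mulrDr.
- by move=> l; rewrite {1}(divz_eq (c l) 2); ring.
- by move=> l; lia.
have sgn (n : int) : (-1 : rat) ^ n = (1 - 2 * (n %% 2)%Z)%:~R.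
  rewrite {1}(divz_eq n 2) expfzDr // mulrC [(n %/ 2)%Z * 2]mulrC -exprz_exp.
  rewrite -[(-1) ^ 2]/((-1) ^+ 2) sqrrN expr1n exp1rz mulr1.
  have [->|->] : (n %% 2)%Z = 0 \/ (n %% 2)%Z = 1 by lia.
    by rewrite expr0z mulr0 subr0.
  by rewrite expr1z mulr1 (_ : 1 - 2 = -1 :> int) // mulrN1z.
move=> l; rewrite -sgn.
have {1}-> : l = \sum_i delta_mx i 0 *~ l i 0.
  apply/colP => j; rewrite summxE (bigD1 j) //= big1 => [|i /negPf ij].
    by rewrite addr0 -scaler_int !mxE !eqxx /= mulr1 intz.
  by rewrite -scaler_int !mxE eq_sym ij /= mulr0.
have -> : chi (\sum_i delta_mx i 0 *~ l i 0) = \prod_i chi (delta_mx i 0) ^ l i 0.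
  by elim/big_rec2: _ => [//|i x y _ <-]; rewrite chiM chiX.
have -> : (-1 : rat) ^ c l = \prod_i (-1) ^ (a i * l i 0).
  by rewrite /c; elim/big_rec2: _ => [|i x y _ <-]; rewrite ?expr0z // expfzDr.
apply: eq_bigr => i _; rewrite /a.
case: (chi1 (delta_mx i 0)) => ->; first by rewrite eqxx mul0r exp1rz.
by rewrite mul1r.
Qed.

(** Clear denominators and divide by the gcd; the Bezout coefficients form [h], which certifies
    primitivity. *)
Lemma primitive_multiple (v : 'rV[rat]_3) : v != 0 ->
  exists (u : 'rV[int]_3) (h : 'cV[int]_3) (s : rat), intM u = s *: v /\ u *m h = 1%:M.
Proof.
move=> v0.
pose D : int := \prod_j denq (v 0 j).
have D0 : D != 0 by apply/prodf_neq0 => j _; rewrite denq_neq0.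
pose x i : int := numq (v 0 i) * \prod_(j | j != i) denq (v 0 j).
have xE i : (x i)%:~R = D%:~R * v 0 i.
  rewrite /x /D [in RHS](bigD1 i) //= !intrM -{3}[v 0 i]divq_num_den.
  by field; rewrite intr_eq0 denq_neq0.
have [a [b ab]] := Bezoutz (x 0) (x 1).
pose g := gcdz (gcdz (x 0) (x 1)) (x 2).
have [c [d cd]] := Bezoutz (gcdz (x 0) (x 1)) (x 2).
have gx (i : 'I_3) : (g %| x i)%Z.
  have g01 : (g %| gcdz (x 0%R) (x 1%R))%Z by exact: dvdz_gcdl.
  by elim/ord3: i; rewrite ?dvdz_gcdr // (dvdz_trans g01) // ?dvdz_gcdl ?dvdz_gcdr.
have g0 : g != 0.
  apply: contraNneq v0 => g0; apply/eqP/rowP => i; rewrite mxE.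
  have := gx i; rewrite g0 dvd0z => /eqP xi.
  by have /esym/eqP := xE i; rewrite xi mulf_eq0 intr_eq0 (negPf D0) => /eqP.
exists (\row_i (x i %/ g)%Z), (col3 (c * a) (c * b) d), (D%:~R / g%:~R); split.
  apply/rowP => i; rewrite !mxE mulrAC -xE.
  by rewrite -{2}(divzK (gx i)) intrM mulfK // intr_eq0.
apply/matrixP => i j; rewrite !ord1 !mxE sum3E !mxE /=; apply: (mulIf g0).
rewrite mul1r; transitivity (c * (a * x 0 + b * x 1) + d * x 2); last by rewrite ab cd.
by rewrite -{2}(divzK (gx 0)) -{2}(divzK (gx 1)) -{2}(divzK (gx 2)); ring.
Qed.

Lemma intMD (K : pzRingType) m n (M N : 'M[int]_(m, n)) : intM (M + N) = intM M + intM N :> 'M[K]_(m, n).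
Proof. exact: map_mxD. Qed.

Lemma intM_mul (K : pzRingType) m n r (M : 'M[int]_(m, n)) (N : 'M[int]_(n, r)) :
  intM (M *m N) = intM M *m intM N :> 'M[K]_(m, r).
Proof. exact: map_mxM. Qed.

Lemma intMZ (K : pzRingType) m n (a : int) (M : 'M[int]_(m, n)) :
  intM (a *: M) = a%:~R *: intM M :> 'M[K]_(m, n).
Proof. exact: map_mxZ. Qed.

Lemma intM0 (K : pzRingType) m n : intM (0 : 'M[int]_(m, n)) = 0 :> 'M[K]_(m, n).
Proof. exact: map_mx0. Qed.

Lemma ratM_mul m n r (M : 'M[rat]_(m, n)) (N : 'M[rat]_(n, r)) :
  ratM (M *m N) = ratM M *m ratM N.
Proof. exact: map_mxM. Qed.

Lemma ratMZ m n (a : rat) (M : 'M[rat]_(m, n)) : ratM (a *: M) = ratr a *: ratM M.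
Proof. exact: map_mxZ. Qed.

(** The signs [sg], [sg * ep], [ep] are the three characters, with integral eigencolumns [H0], [H1],
    [H2] whose sum is even. The rows [v0], [v1] are dual to [w0], [w1]. *)
Lemma klein_action (p : nat) (A : 'cV[int]_p -> 'M[int]_3)
    (c k K d e E : 'cV[int]_p -> int) (H0 H1 H2 h : 'cV[int]_3) (u : 'rV[int]_3)
    (w0 w1 : 'cV[rat]_3) (v0 v1 : 'rV[rat]_3) :
  let sg l := 1 - 2 * k l in let ep l := 1 - 2 * e l in
  A 0 = 1%:M -> (forall l m : 'cV[int]_p, A (l + m) = A l *m A m) ->
  (forall l m, c (l + m) = c l + c m) -> (forall l, c l = k l + 2 * K l) ->
  (forall l, k l = 0 \/ k l = 1) ->
  (forall l m, d (l + m) = d l + d m) -> (forall l, d l = e l + 2 * E l) ->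
  (forall l, e l = 0 \/ e l = 1) ->
  (forall l, A l *m H0 = sg l *: H0) -> (forall l, A l *m H1 = (sg l * ep l) *: H1) ->
  (forall l, A l *m H2 = ep l *: H2) -> H0 + H1 + H2 = 2 *: h ->
  (forall l, u *m A l = ep l *: u) -> u *m H0 = 0 -> u *m H1 = 0 -> u *m H2 = 2%:M ->
  (forall l, intM (A l) *m w0 = (sg l)%:~R *: w0) ->
  (forall l, intM (A l) *m w1 = (sg l * ep l)%:~R *: w1) ->
  intM u *m w0 = 0 -> intM u *m w1 = 0 ->
  (forall l, v0 *m intM (A l) = (sg l)%:~R *: v0) ->
  (forall l, v1 *m intM (A l) = (sg l * ep l)%:~R *: v1) ->
  v0 *m w0 = 1%:M -> v0 *m w1 = 0 -> v1 *m w0 = 0 -> v1 *m w1 = 1%:M ->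
  exists F, torus_action F /\ free_action F /\ induces F A.
Proof.
move=> sg ep A0 AD cD cE k01 dD dE e01 AH0 AH1 AH2 Hh uA uH0 uH1 uH2 Aw0 Aw1 uw0 uw1
  v0A v1A vw00 vw01 vw10 vw11.
have [tau tauT] := transcendental_exists.
pose t (l : 'cV[int]_p) : Rl := \sum_i (l i 0)%:~R * tau ^+ i.+1.
(* As [u H2 = 2], the term [c l *: H2] over 4 moves [u x] by [c l / 2]. The other terms, killed by
   [u], repair its failure to be a cocycle modulo 4. *)
pose bt (l : 'cV[int]_p) : 'cV[int]_3 := c l *: H2 - sg l *: (d l *: H0 + e l *: H1).
pose th (x : 'cV[Rl]_3) : Rl := 2 * pi * (intM u *m x) 0 0.
pose X (x : 'cV[Rl]_3) : 'cV[Rl]_3 := cos (th x) *: ratM w0 + sin (th x) *: ratM w1.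
(* The first summand turns the fibres of [x |-> u x] by the flow of the field [X],
   which is equivariant because the affine part acts on [u x] by half-turns and
   reflections; the cocycle [bt / 4] closes up modulo the lattice. *)
pose F l (x : 'cV[Rl]_3) : 'cV[Rl]_3 := intM (A l) *m (x + t l *: X x) + 4^-1 *: intM (bt l).
have tD l m : t (l + m) = t l + t m.
  by rewrite /t -big_split; apply: eq_bigr => i _; rewrite mxE intrD mulrDl.
have t0 : t 0 = 0 by rewrite /t big1 // => i _; rewrite mxE mul0r.
have ep1 l : ep l = 1 \/ ep l = -1 by rewrite /ep; case: (e01 l) => ->; [left|right].
have kD l m : k (l + m) = k l + k m - 2 * k l * k m.
  have := cD l m; rewrite !cE.
  by case: (k01 l) (k01 m) (k01 (l + m)) => -> [->|->] [->|->]; lia.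
have eD l m : e (l + m) = e l + e m - 2 * e l * e m.
  have := dD l m; rewrite !dE.
  by case: (e01 l) (e01 m) (e01 (l + m)) => -> [->|->] [->|->]; lia.
have btD l m : exists q, bt (l + m) = bt l + A l *m bt m + 4 *: q.
  (* The [H2] terms leave [2 * e l * c m] times [H2]; its odd part becomes a multiple of 4 up to
     [H0] and [H1] on replacing [H2] by [2 h - H0 - H1]. *)
  exists ((e l * k m) *: h - (k l * e l * k m) *: (H0 + H1)
          + (sg l * E l * k m) *: H0 + (e l * K m) *: H2).
  rewrite /bt mulmxBr -!scalemxAr mulmxDr -!scalemxAr AH0 AH1 AH2 /sg /ep.
  apply/colP => i; rewrite !mxE cD dD kD eD !cE !dE.
  have -> : H2 i 0 = 2 * h i 0 - H0 i 0 - H1 i 0.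
    by have /colP/(_ i) := Hh; rewrite !mxE => <-; ring.
  case: (e01 l) (k01 m) => -> [->|->]; ring.
have ubt l : u *m bt l = (2 * c l)%:M.
  rewrite /bt mulmxBr -!scalemxAr mulmxDr -!scalemxAr uH0 uH1 uH2.
  by rewrite !scaler0 addr0 scaler0 subr0 scale_scalar_mx mulrC.
have uX x : intM u *m X x = 0.
  rewrite /X mulmxDr -!scalemxAr -!(ratM_intM _ _ u) -!ratM_mul uw0 uw1.
  by rewrite /ratM map_mx0 !scaler0 addr0.
have uF l x : (intM u *m F l x) 0 0 = (ep l)%:~R * (intM u *m x) 0 0 + (c l)%:~R / 2.
  rewrite /F mulmxDr mulmxA -intM_mul uA intMZ -scalemxAl mulmxDr -!scalemxAr uX.
  rewrite scaler0 addr0 -intM_mul ubt !mxE eqxx mulr1n intrM.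
  by field.
(* The half-turns multiply cosine and sine by [sg l], the reflection changes the sign of sine only:
   these are the eigenvalues on [w0] and [w1]. Hence flow times add under composition. *)
have XF l x : X (F l x) = intM (A l) *m X x.
  have -> : X (F l x) = ((sg l)%:~R * cos (th x)) *: ratM w0 +
      ((sg l * ep l)%:~R * sin (th x)) *: ratM w1.
    rewrite /X; have -> : th (F l x) = (ep l)%:~R * th x + (k l + 2 * K l)%:~R * pi.
      by rewrite /th uF cE; field.
    rewrite cos_half_turns // sin_half_turns // -/(sg l).
    by case: (ep1 l) => ->; rewrite ?mulr1 ?mul1r // mulrN1 mulrN1z mulN1r cosN sinN mulrNz mulNr mulrN.
  rewrite /X mulmxDr -!scalemxAr -!(ratM_intM _ _ (A l)) -!ratM_mul Aw0 Aw1 !ratMZ !ratr_int.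
  by rewrite !scalerA ![_%:~R * _]mulrC.
have Xk x (q : 'cV[int]_3) : X (x + intM q) = X x.
  rewrite /X; have -> : th (x + intM q) = th x + (pi *+ 2) *~ (u *m q) 0 0 .
    rewrite /th mulmxDr -intM_mul !mxE -mulrzl -mulr_natl; ring.
  by rewrite (periodicz _ _ _ _ (@cosD2pi Rl)) (periodicz _ _ _ _ (@sinD2pi Rl)).
exists F; split; first split.
- move=> x; apply/in_latticeP; exists 0; rewrite /F A0 t0 scale0r addr0.
  have -> : bt 0 = 0.
    have [c0 d0] : c 0 = 0 /\ d 0 = 0.
      by have := cD 0 0; have := dD 0 0; rewrite addr0; lia.
    have e0 : e 0 = 0 by have := dE 0; case: (e01 0); lia.
    by rewrite /bt c0 d0 e0 !scale0r addr0 scaler0 subr0.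
  by rewrite intM0 scaler0 addr0 /intM map_mx1 mul1mx subrr.
- split=> [l m x|l]; last first.
    move=> i x0; pose V (w : 'cV[rat]_3) : Rl := (intM (A l) *m ratM w) i 0.
    have lin := analytic_atD _ _ _ (analytic_at_linear (intM (A l) i) x0)
      (analytic_at_cst ((4^-1 *: intM (bt l)) i 0) x0).
    have ac := analytic_atZ (t l * V w0) _ _
      (analytic_at_cos (fun j => 2 * pi * (u 0 j)%:~R) 0 x0).
    have sn := analytic_atZ (t l * V w1) _ _
      (analytic_at_sin (fun j => 2 * pi * (u 0 j)%:~R) 0 x0).
    apply: (analytic_at_ext _ _ _ _ (analytic_atD _ _ _ lin (analytic_atD _ _ _ ac sn))) => x.
    have -> : \sum_j 2 * pi * (u 0 j)%:~R * x j 0 + 0 = th x.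
      rewrite addr0 /th mxE mulr_sumr; apply: eq_bigr => j _.
      by rewrite mxE mulrA.
    rewrite /F /X mulmxDr -scalemxAr mulmxDr -!scalemxAr.
    have -> : \sum_j intM (A l) i j * x j 0 = (intM (A l) *m x) i 0 by rewrite mxE.
    rewrite /V; move: (_ *m x) (_ *m ratM w0) (_ *m ratM w1) => y y0 y1.
    by rewrite !mxE; ring.
  have [q btq] := btD l m; apply/in_latticeP; exists q.
  have -> : F l (F m x) = intM (A l) *m (F m x + t l *: (intM (A m) *m X x)) + 4^-1 *: intM (bt l).
    by rewrite -XF.
  rewrite /F btq AD tD; move: (X x) (bt l) (bt m) (t l) (t m) => Xx b b' a a'.
  rewrite !intMD !intM_mul intMZ (scalerDl _ a a') !(mulmxDr, scalerDr).
  rewrite -!scalemxAr !mulmxA.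
  move: (_ *m x) (_ *m Xx) (_ *m intM b') => y y' y''.
  by apply/colP => i; rewrite !mxE; field.
split; last first.
  move=> l x q; rewrite /F Xk [x + _ + _]addrAC (mulmxDr _ _ (intM q)) -intM_mul.
  by rewrite addrAC.
move=> l l0 x /in_latticeP[q Fq].
have tq := tau_sqr_irrational tau p l tauT l0; rewrite -/(t l) in tq.
(* When the sign [s] is 1, [x] cancels and [t l] times the pairing of [v] with [X x] is rational. *)
have vF (v : 'rV[rat]_3) (s : int) : v *m intM (A l) = s%:~R *: v ->
    exists r r', s%:~R * ((ratM v *m x) 0 0 + t l * (ratM v *m X x) 0 0) + ratr r
      - (ratM v *m x) 0 0 = ratr r' :> Rl.
  move=> vA; exists (4^-1 * (v *m intM (bt l)) 0 0), ((v *m intM q) 0 0).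
  have := congr1 (fun y => (ratM v *m y) 0 0) Fq.
  rewrite /F mulmxBr mulmxDr mulmxA -!(ratM_intM _ _ (A l)) -ratM_mul vA ratMZ ratr_int.
  rewrite -scalemxAl mulmxDr -!scalemxAr -!(ratM_intM _ _ (bt l)) -(ratM_intM _ _ q) -!ratM_mul.
  move: (ratM v *m x) (ratM v *m X x) (v *m intM (bt l)) (v *m intM q) => y y' y'' y3.
  by rewrite !mxE => <-; rewrite rmorphM /= fmorphV /= rmorph_nat.
have v0X : (ratM v0 *m X x) 0 0 = cos (th x).
  rewrite /X mulmxDr -!scalemxAr -!ratM_mul vw00 vw01 /ratM map_mx1 map_mx0.
  by rewrite !mxE !mulr1n mulr0 addr0 mulr1.
have v1X : (ratM v1 *m X x) 0 0 = sin (th x).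
  rewrite /X mulmxDr -!scalemxAr -!ratM_mul vw10 vw11 /ratM map_mx1 map_mx0.
  by rewrite !mxE !mulr1n mulr0 add0r mulr1.
have [r0 [r0']] := vF v0 _ (v0A l); rewrite v0X.
have [r1 [r1']] := vF v1 _ (v1A l); rewrite v1X.
have [n] : exists n : int, (ep l)%:~R * (intM u *m x) 0 0 + (c l)%:~R / 2 - (intM u *m x) 0 0
    = n%:~R :> Rl.
  exists ((u *m q) 0 0); have := congr1 (fun y => (intM u *m y) 0 0) Fq.
  by rewrite -intM_mul mulmxBr [LHS]mxE uF !mxE => <-.
have := trigo.cos2Dsin2 (th x).
rewrite /th; set z := (intM u *m x) 0 0; set C := cos _; set S := sin _.
rewrite /sg /ep cE.
have tcos r r' : t l * C = ratr r - ratr r' -> C ^+ 2 = 1 -> False.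
  move=> tC C1; apply: (tq ((r - r') ^+ 2)).
  by rewrite rmorphXn /= rmorphB /= -tC exprMn C1 mulr1.
have tsin r r' : t l * S = ratr r - ratr r' -> S ^+ 2 = 1 -> False.
  move=> tS S1; apply: (tq ((r - r') ^+ 2)).
  by rewrite rmorphXn /= rmorphB /= -tS exprMn S1 mulr1.
(* For signs [sg], [ep] equal to 1, 1, both [t C] and [t S] are rational, hence [t ^+ 2] is. For 1,
   -1, the row [u] forces [S = 0] and [t C] is rational. For -1, 1, [u] gives an odd integer equal
   to an even one. For -1, -1, [u] forces [C = 0] and [t S] is rational. *)
case: (k01 l) (e01 l) => -> [] -> CS.
- rewrite !mulr0 !subr0 mulr1 !mul1r => _ E1 E0.
  apply: (tq ((r0' - r0) ^+ 2 + (r1' - r1) ^+ 2)).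
  rewrite rmorphD !rmorphXn /= !rmorphB /= -E0 -E1; move: CS; nra.
- rewrite !mulr0 !subr0 mulr1 add0r (_ : 1 - 2 = -1 :> int) // intrN !mulN1r => zE _ E0.
  have S0 : S = 0.
    rewrite /S (_ : 2 * pi * z = (K l - n)%:~R * pi); first exact: sin_pi_int.
    by rewrite intrB -zE intrM; field.
  by apply: (tcos r0' r0); [rewrite -E0; ring|move: CS; rewrite S0; lra].
- rewrite !mulr0 !subr0 !mul1r => zE _ _.
  have : (1 + 2 * K l)%:~R = (2 * n)%:~R :> Rl by rewrite [RHS]intrM -zE; field.
  by move/intr_inj; lia.
- rewrite !mulr1 (_ : (1 - 2) * (1 - 2) = 1 :> int) // (_ : 1 - 2 = -1 :> int) // mulrN1z mul1r !mulN1r => zE E1 _.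
  have C0 : C = 0.
    rewrite /C (_ : 2 * pi * z = (K l - n)%:~R * pi + pi / 2).
      by rewrite trigo.cosDpihalf sin_pi_int oppr0.
    by rewrite intrB -zE !intrD intrM; field.
  by apply: (tsin r1' r1); [rewrite -E1; ring|move: CS; rewrite C0; lra].
Qed.

(** * Characters whose kernels cover the group *)

(** A group is not the union of two proper subgroups, here the two kernels. *)
Lemma common_nontrivial (V : zmodType) (K : fieldType) (x y : V -> K) :
  (forall l m, x (l + m) = x l * x m) -> (forall l m, y (l + m) = y l * y m) ->
  (exists l, x l != 1) -> (exists l, y l != 1) -> exists l, x l != 1 /\ y l != 1.
Proof.
move=> xM yM [a xa] [b yb].
have [ya|ya] := eqVneq (y a) 1; last by exists a.
have [xb|xb] := eqVneq (x b) 1; last by exists b.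
by exists (a + b); rewrite xM yM xb ya mulr1 mul1r.
Qed.

(* A group is the union of three proper subgroups only if their intersection has
   the Klein four-group as quotient. *)
Lemma three_characters (V : zmodType) (x y z : V -> rat) :
  (forall l m, x (l + m) = x l * x m) -> (forall l m, y (l + m) = y l * y m) ->
  (forall l m, z (l + m) = z l * z m) ->
  (forall l, [\/ x l = 1, y l = 1 | z l = 1]) ->
  (exists l, x l != 1) -> (exists l, y l != 1) -> (exists l, z l != 1) ->
  [/\ forall l, x l = 1 \/ x l = -1, forall l, z l = 1 \/ z l = -1,
      forall l, y l = x l * z l &
      exists g h, [/\ x g = -1, z g = 1, x h = 1 & z h = -1]].
Proof.
move=> xM yM zM cover x1 y1 z1.
have [g [/eqP xg /eqP yg]] := common_nontrivial _ _ _ _ xM yM x1 y1.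
have [h [/eqP yh /eqP zh]] := common_nontrivial _ _ _ _ yM zM y1 z1.
have zg : z g = 1 by case: (cover g).
have xh : x h = 1 by case: (cover h).
have ygh : y g * y h = 1.
  by case: (cover (g + h)); rewrite ?xM ?yM ?zM ?xh ?zg ?mulr1 ?mul1r.
have sq1 (a : rat) : a <> 1 -> a * a = 1 -> a = -1.
  move=> a1 aa; have /eqP : (a - 1) * (a + 1) = 0 by ring: aa.
  by rewrite mulf_eq0 subr_eq0 addr_eq0 => /orP[/eqP//|/eqP].
(* Each sign is found by evaluating [cover] at an element where the other two characters differ from
   1. *)
have {}xg : x g = -1.
  apply: sq1 => //; case: (cover (g + g + h)); rewrite ?xM ?yM ?zM ?xh ?zg ?mulr1 ?mul1r //.
  by rewrite -mulrA ygh mulr1.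
have {}zh : z h = -1.
  apply: sq1 => //; case: (cover (g + h + h)); rewrite ?xM ?yM ?zM ?xh ?zg ?xg ?mulr1 ?mul1r //.
  by rewrite ygh mul1r.
have {}yg : y g = -1.
  apply: sq1 => //; case: (cover (g + g + (g + h))).
  - by rewrite !xM xg xh; lra.
  - by rewrite !yM ygh mulr1.
  - by rewrite !zM zg zh; lra.
have {}yh : y h = -1 by move: ygh; rewrite yg; lra.
(* Covering [l] and its translates by [g], [h] and [g + h] gives four clauses on the signs at [l],
   which leave only these values. *)
have pm l : [/\ x l = 1 \/ x l = -1, z l = 1 \/ z l = -1 & y l = x l * z l].
  have := cover l; have := cover (l + g); have := cover (l + h).
  have := cover (l + g + h); rewrite !xM !yM !zM xg yg zg xh yh zh.
  rewrite !(mulrN1, mulr1, opprK); move: (x l) (y l) (z l) => a b c B4 B3 B2 B1.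
  have or3b (s s' s'' : rat) : [\/ s = 1, s' = 1 | s'' = 1] -> [|| s == 1, s' == 1 | s'' == 1].
    by case=> ->; rewrite eqxx ?orbT.
  move: B4 B3 B2 B1 => /or3b + /or3b + /or3b + /or3b; rewrite !eqr_oppLR.
  have ex (s : rat) : ~~ ((s == 1) && (s == -1)) by apply/andP => -[/eqP-> /eqP].
  have bool_cover (pa na pb nb pc nc : bool) :
      ~~ (pa && na) -> ~~ (pb && nb) -> ~~ (pc && nc) ->
      [|| na, pb | nc] -> [|| pa, nb | nc] -> [|| na, nb | pc] -> [|| pa, pb | pc] ->
      ((pa && pc || na && nc) && pb) || ((pa && nc || na && pc) && nb).
    by case: pa na pb nb pc nc => [] [] [] [] [] [].
  move=> B4 B3 B2 B1.
  have := bool_cover _ _ _ _ _ _ (ex a) (ex b) (ex c) B4 B3 B2 B1.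
  by move=> /orP[] /andP[/orP[] /andP[/eqP-> /eqP->] /eqP->];
    split; rewrite ?mulr1 ?mul1r ?mulrNN ?mulr1 //; by [left|right].
split=> [l|l|l|]; [by case: (pm l)..|].
by exists g, h.
Qed.

(** * Diagonalizable actions and the final case distinction *)

(** The diagonal entries are characters, and eigenvalue 1 says that their kernels cover the group. A
    trivial one gives a fixed row and column with nonzero pairing; otherwise the Klein case
    applies. *)
Lemma diag_action (p : nat) (A : 'cV[int]_p -> 'M[int]_3) (P : 'M[rat]_3)
    (d : 'cV[int]_p -> 'rV[rat]_3) :
  A 0 = 1%:M -> (forall l m : 'cV[int]_p, A (l + m) = A l *m A m) ->
  (forall l, eigenvalue (intM (A l) : 'M[rat]_3) 1) ->
  P \in unitmx -> (forall l, P *m intM (A l) = diag_mx (d l) *m P) ->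
  exists F, torus_action F /\ free_action F /\ induces F A.
Proof.
move=> A0 AD A1 Pu PA.
have dM i l m : d (l + m) 0 i = d l 0 i * d m 0 i.
  have : diag_mx (d (l + m)) = diag_mx (d l) *m diag_mx (d m).
    apply: (can_inj (mulmxK Pu)).
    by rewrite -PA AD intM_mul mulmxA PA -mulmxA PA mulmxA.
  by rewrite mulmx_diag => /matrixP/(_ i i); rewrite !mxE eqxx !mulr1n.
have cover l : exists i, d l 0 i = 1.
  have /eigenvalueP[v] := A1 l; rewrite scale1r => vA v0.
  pose y := v *m invmx P.
  have yd : y *m diag_mx (d l) = y.
    by rewrite /y -[in LHS](mulmxK Pu (diag_mx _)) -PA !mulmxA mulmxKV // vA.
  have /rV0Pn[i yi] : y != 0.
    by apply: contraNneq v0 => y0; rewrite -(mulmxKV Pu v) -/y y0 mul0mx.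
  exists i; apply: (mulfI yi); rewrite mulr1.
  by have /rowP/(_ i) := yd; rewrite mul_mx_diag mxE.
have rowPA i l : row i P *m intM (A l) = d l 0 i *: row i P.
  by rewrite -row_mul PA row_mul row_diag_mx -scalemxAl -rowE.
have colPA i l : intM (A l) *m col i (invmx P) = d l 0 i *: col i (invmx P).
  apply: (can_inj (mulKmx Pu)); rewrite mulmxA PA -mulmxA -scalemxAr !colE mulKVmx //.
  rewrite mul_diag_mx; apply/colP => j; rewrite !mxE.
  by case: eqVneq => [->|]; rewrite ?mulr0.
have rc i j : row i P *m col j (invmx P) = if i == j then 1%:M else 0.
  rewrite -row_mul colE mulKVmx //; apply/matrixP => a b.
  by rewrite !ord1 !mxE eqxx andbT; case: eqP; rewrite mxE.
have [[i di]|/forallNP nt] := pselect (exists i, forall l, d l 0 i = 1).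
  apply: (fixed_pairing_action p A (row i P) (col i (invmx P))) => //.
  - by move=> l; rewrite rowPA di scale1r.
  - by move=> l; rewrite colPA di scale1r.
  - by rewrite rc eqxx -mxrank_eq0 mxrank1.
have {}nt i : exists l, d l 0 i != 1.
  by have /existsNP[l /eqP] := nt i; exists l.
have [|x1 z1 yxz [g [h [xg zg xh zh]]]] := three_characters _ _ _ _ (dM 0) (dM 1) (dM 2) _ (nt 0) (nt 1) (nt 2).
  move=> l; have [i] := cover l; elim/ord3: i => di.
  - exact: Or31.
  - exact: Or32.
  - exact: Or33.
have [c [k [K [cD cE k01 xE]]]] := sign_lift p _ (dM 0) x1.
have [dd [e [E [dD dE e01 zE]]]] := sign_lift p _ (dM 2) z1.
have yE l : d l 0 1 = ((1 - 2 * k l) * (1 - 2 * e l))%:~R by rewrite yxz xE zE intrM.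
have row2 : row 2 P != 0.
  by apply/eqP => r0; have := rc 2 2; rewrite r0 mul0mx eqxx => /eqP; rewrite eq_sym -mxrank_eq0 mxrank1.
have [u [hv [s [us uh]]]] := primitive_multiple _ row2.
have intM_inj m n : injective (@intM rat m n).
  by move=> M N /matrixP MN; apply/matrixP => i j; have := MN i j; rewrite !mxE => /intr_inj.
have uA l : u *m A l = (1 - 2 * e l) *: u.
  apply: intM_inj; rewrite intM_mul intMZ us -scalemxAl rowPA -zE.
  by rewrite !scalerA mulrC.
have Pinj (y y' : 'cV[int]_3) : (forall i, (P *m intM y) i 0 = (P *m intM y') i 0) -> y = y'.
  by move=> yy'; apply/intM_inj/(can_inj (mulKmx Pu))/colP.
have PG l i (y : 'cV[int]_3) : (P *m intM (A l *m y)) i 0 = d l 0 i * (P *m intM y) i 0.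
  by rewrite intM_mul mulmxA PA -mulmxA mul_diag_mx mxE.
have PD i (y y' : 'cV[int]_3) :
    (P *m intM (y + y')) i 0 = (P *m intM y) i 0 + (P *m intM y') i 0.
  by rewrite intMD mulmxDr mxE.
(* [1 + A l] scales the eigencoordinates by [1 + d l 0 i]. At [h], [g + h], [g] it doubles the
   coordinate 0, 1, 2 respectively and kills the others, so the three images of [hv] are integral
   eigencolumns with sum [2 hv]. *)
have [H HE] : exists H, forall l, H l = hv + A l *m hv by eexists.
have PH l i : (P *m intM (H l)) i 0 = (1 + d l 0 i) * (P *m intM hv) i 0.
  by rewrite HE PD PG mulrDl mul1r.
have PZ (a : int) i (y : 'cV[int]_3) : (P *m intM (a *: y)) i 0 = a%:~R * (P *m intM y) i 0.
  by rewrite intMZ -scalemxAr mxE.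
have uH l : u *m H l = (1 + (1 - 2 * e l))%:M.
  by rewrite HE mulmxDr mulmxA uA -scalemxAl uh scale_scalar_mx mulr1 -raddfD.
have e_eq l (a : int) : d l 0 2 = a%:~R -> 1 - 2 * e l = a by rewrite zE => /intr_inj.
apply: (klein_action p A c k K dd e E (H h) (H (g + h)) (H g) hv u
  (col 0 (invmx P)) (col 1 (invmx P)) (row 0 P) (row 1 P)) => //.
- move=> l; apply: Pinj; apply: ord3; rewrite PG PZ !PH -?xE ?yxz ?xh ?zh; ring.
- move=> l; apply: Pinj; apply: ord3; rewrite PG PZ !PH -?yE !dM ?yxz ?xg ?zg ?xh ?zh; ring.
- move=> l; apply: Pinj; apply: ord3; rewrite PG PZ !PH -?zE ?yxz ?xg ?zg; ring.
- apply: Pinj; apply: ord3; rewrite !PD PZ !PH !dM ?yxz ?xg ?zg ?xh ?zh; ring.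
- by rewrite uH (e_eq h (-1)) // subrr raddf0.
- by rewrite uH (e_eq (g + h) (-1)) ?subrr ?raddf0 // dM zg zh.
- by rewrite uH (e_eq g 1).
- by move=> l; rewrite colPA xE.
- by move=> l; rewrite colPA yE.
- by rewrite us -scalemxAl rc /= scaler0.
- by rewrite us -scalemxAl rc /= scaler0.
- by move=> l; rewrite rowPA xE.
- by move=> l; rewrite rowPA yE.
Qed.

Theorem theorem1 (p : nat) (hp : (2 <= p)%N) (A : 'cV[int]_p -> 'M[int]_3) :
  spectrally_unitary A ->
  exists F : 'cV[int]_p -> 'cV[Rl]_3 -> 'cV[Rl]_3,
    torus_action F /\ free_action F /\ induces F A.
Proof.
move=> [AD [Au A1]].
have A0 : A 0 = 1%:M.
  by apply: (can_inj (mulmxK (Au 0))); rewrite mul1mx -AD addr0.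
pose g l : 'M[rat]_3 := intM (A l).
have gD l m : g (l + m) = g l *m g m by rewrite /g AD intM_mul.
have gC l m : g l *m g m = g m *m g l by rewrite -!gD addrC.
have [|//|[v v0 vA]|[P Pu [d PA]]] := fixed_row_or_diag g gC; last 1 first.
- exact: (diag_action p A P d).
- by move=> l m; exists (l + m).
(* A fixed row of the transposes is a fixed column of [A]. *)
have [| | |[w w0 wA]|[P Pu [d PA]]] := fixed_row_or_diag (fun l => (g l)^T).
- by move=> l m; rewrite -!trmx_mul gC.
- by move=> l m; exists (l + m); rewrite -trmx_mul gD gC.
- move=> l; rewrite eigenvalue_root_char /char_poly -det_tr.
  have -> : (char_poly_mx (g l)^T)^T = char_poly_mx (g l).
    by rewrite /char_poly_mx linearB /= tr_scalar_mx map_trmx trmxK.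
  by rewrite -/(char_poly _) -eigenvalue_root_char; exact: A1.
- have Aw l : g l *m w^T = w^T by rewrite -[in RHS](wA l) trmx_mul trmxK.
  have [vw|vw] := eqVneq (v *m w^T) 0.
    by apply: (fixed_orthogonal_action p A v w^T); rewrite ?trmx_eq0.
  exact: (fixed_pairing_action p A v w^T).
(* Diagonalizing the transposes by [P] diagonalizes [A] by the inverse transpose. *)
apply: (diag_action p A (invmx P^T) d) => // [|l]; first by rewrite unitmx_inv unitmx_tr.
apply: (can_inj (mulmxK (_ : P^T \in unitmx))); first by rewrite unitmx_tr.
rewrite mulmxKV ?unitmx_tr // -mulmxA.
have -> : intM (A l) *m P^T = P^T *m diag_mx (d l).
  by have /(congr1 trmx) := PA l; rewrite !trmx_mul trmxK tr_diag_mx.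
by rewrite mulKmx // unitmx_tr.
Qed.
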